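(* Let $d$ be a constant and let $H$ be a fixed graph with $k$ vertices and $\ell$ edges. Then, given an $n$-vertex $d$-degenerate graph $G$, both $\mathrm{hom}(H,G)$ and $\mathrm{sub}(H,G)$ can be computed in time $O(f(k,d)\cdot n^{\lfloor \ell/5\rfloor+3})$ for some function $f$, using constant space.
   Context: A graph is $d$-degenerate if every subgraph has a vertex of degree at most $d$. $\mathrm{hom}(H,G)$ is the number of maps $\phi:V(H)\to V(G)$ such that $\{\phi(u),\phi(v)\}\in E(G)$ whenever $\{u,v\}\in E(H)$; $\mathrm{sub}(H,G)$ is the number of subgraphs of $G$ isomorphic to $H$. Algorithms are in the unit-cost RAM model; $H$ and $d$ are treated as constants, and constant space means a number of memory words bounded by a function of $k$ and $d$ only. *)

(* Defs.v *)
From mathcomp Require Import all_boot.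
Set Implicit Arguments.
Unset Strict Implicit.
Unset Printing Implicit Defensive.

Definition simple_graph (T : finType) (e : rel T) : Prop :=
  symmetric e /\ irreflexive e.

Definition nedges (k : nat) (e : rel 'I_k) : nat :=
  #|[set p : 'I_k * 'I_k | (p.1 < p.2) && e p.1 p.2]|.

Definition degenerate (d : nat) (T : finType) (e : rel T) : Prop :=
  forall (S : {set T}) (E' : rel T),
    S != set0 -> symmetric E' ->
    (forall u v, E' u v -> [&& u \in S, v \in S & e u v]) ->
    exists2 v, v \in S & #|[set u in S | E' v u]| <= d.

Definition hom (k n : nat) (eH : rel 'I_k) (eG : rel 'I_n) : nat :=
  #|[set phi : {ffun 'I_k -> 'I_n} |
       [forall i, forall j, eH i j ==> eG (phi i) (phi j)]]|.

(* A subgraph of G: vertex set S and a set F of edges of G (2-element sets)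
   with both endpoints in S; it is isomorphic to H if some bijection
   'I_k -> S maps edges of H exactly onto F. *)
Definition sub_iso (k n : nat) (eH : rel 'I_k) (eG : rel 'I_n)
    (SF : {set 'I_n} * {set {set 'I_n}}) : bool :=
  [forall F in SF.2, exists u, exists v,
      [&& eG u v, F == [set u; v], u \in SF.1 & v \in SF.1]] &&
  [exists phi : {ffun 'I_k -> 'I_n},
      [&& injectiveb phi, phi @: setT == SF.1 &
          [forall i, forall j, ([set phi i; phi j] \in SF.2) == eH i j]]].

Definition sub (k n : nat) (eH : rel 'I_k) (eG : rel 'I_n) : nat :=
  #|[set SF | sub_iso eH eG SF]|.

(* ---------- Input encoding: adjacency lists (CSR form) ----------
   inp = n :: off_0 :: ... :: off_n :: (neighbours of 0) ++ ... ++ (neighbours of n-1)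
   where off_v is the absolute position in inp of the start of v's list. *)
Definition adj_encoding (n : nat) (eG : rel 'I_n) (inp : seq nat) : Prop :=
  exists L : seq (seq nat),
    [/\ size L = n,
        (forall v : 'I_n, uniq (nth [::] L v) /\
           (forall x, x \in nth [::] L v -> x < n) /\
           (forall u : 'I_n, (val u \in nth [::] L v) = eG v u)) &
        inp = n :: [seq n + 2 + sumn (map size (take i L)) | i <- iota 0 n.+1]
                 ++ flatten L].

(* ---------- Unit-cost word RAM ----------
   Registers r_0, r_1, ... hold naturals; the input is read-only. *)
Inductive instr : Type :=
| IConst (i c : nat)
| IAdd (i j l : nat)
| ISub (i j l : nat)        (* r_i := r_j - r_l (truncated) *)
| IMul (i j l : nat)
| IDiv (i j l : nat)        (* r_i := r_j / r_l (0 if r_l = 0) *)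
| IMod (i j l : nat)
| ILoad (i j : nat)
| IStore (i j : nat)
| IRead (i j : nat)         (* r_i := inp[r_j] (0 out of range) *)
| IJz (i t : nat)
| IJmp (t : nat)
| IHalt.

Record state := State { pc : nat; mem : nat -> nat }.

Inductive result := Crash | Halted of nat | Next of state.

(* One step, with a space bound S (only registers 0..S-1 may be accessed)
   and a word bound W (no register may ever hold a value > W).
   Violations crash. *)
Definition step (S W : nat) (inp : seq nat) (P : seq instr) (s : state) : result :=
  let m := mem s in
  let rd j (k : nat -> result) := if j < S then k (m j) else Crash in
  let wr i v := if (i < S) && (v <= W) then
                  Next (State (pc s).+1 (fun a => if a == i then v else m a))
                else Crash in
  if pc s < size P then
    match nth IHalt P (pc s) with
    | IConst i c => wr i c
    | IAdd i j l => rd j (fun a => rd l (fun b => wr i (a + b)))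
    | ISub i j l => rd j (fun a => rd l (fun b => wr i (a - b)))
    | IMul i j l => rd j (fun a => rd l (fun b => wr i (a * b)))
    | IDiv i j l => rd j (fun a => rd l (fun b => wr i (a %/ b)))
    | IMod i j l => rd j (fun a => rd l (fun b => wr i (a %% b)))
    | ILoad i j => rd j (fun a => rd a (fun b => wr i b))
    | IStore i j => rd i (fun a => rd j (fun b => wr a b))
    | IRead i j => rd j (fun a => wr i (nth 0 inp a))
    | IJz i t => rd i (fun a => Next (State (if a == 0 then t else (pc s).+1) m))
    | IJmp t => Next (State t m)
    | IHalt => rd 0 (fun a => Halted a)
    end
  else Crash.

Fixpoint exec (S W : nat) (inp : seq nat) (P : seq instr) (fuel : nat) (s : state)
    : option nat :=
  match fuel with
  | 0 => None
  | fuel'.+1 =>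
    match step S W inp P s with
    | Crash => None
    | Halted o => Some o
    | Next s' => exec S W inp P fuel' s'
    end
  end.

Definition init_state : state := State 0 (fun _ => 0).

Definition run (S W : nat) (inp : seq nat) (P : seq instr) (T : nat) : option nat :=
  exec S W inp P T init_state.

(* Main.v *)
From Stdlib Require Import FunctionalExtensionality ClassicalEpsilon.
Require Import Defs.
From mathcomp Require Import all_boot.
From mathcomp Require Import zify.
Set Implicit Arguments.
Unset Strict Implicit.
Unset Printing Implicit Defensive.

(* No orientation of G is computed: degeneracy enters only through the bound dn
   on the number of edges, so that a loop over the edges of G (which fixes two
   vertices of H) costs O(n), like a loop over its vertices.  Once an edge or a
   vertex of H has been placed, the components that remain are counted
   separately and multiplied, in constant space.  The exponent is thus the depth
   of an elimination of H by edges and vertices, and this depth is at most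
   l/5 + 3: while some edge xy has deg x + deg y >= 6, deleting x and y removes
   at least 5 edges.  Otherwise put M = sum of (deg - 1); then 12 M <= 14 l, and
   depth M/6 + 3 suffices.  Indeed, if some vertex set spans more edges than
   vertices, a minimal such set contains a vertex of degree 3 whose neighbours all
   have degree 2, and deleting it with a suitable neighbour lowers M by 6; if not,
   each component is a forest after the deletion of one vertex, and forests have
   logarithmic depth by centroids.

   For sub, inclusion-exclusion over the sets A of identified pairs of vertices
   expresses the number of injective homomorphisms by the hom(H/A, G), where H/A
   has at most l edges; dividing by the number of automorphisms gives sub. *)

(** * Elimination orders of the pattern *)

(** Two losses fix the exponent. Deleting an edge of degree sum exactly 6 removes 5 edges for one
    unit, so the slope 1/5 has no slack there; in the other regime M/6 <= 7l/36 stays below l/5. The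
    additive 3 is decided on sparse components: centroid depth t + 1 reaches 1, 4, 10, 22, ...
    vertices, at least 6t - 2 for t >= 1, so the logarithm costs no more than one unit per 6 units
    of M, the price of a deletion in the dense case. A cycle costs one further deletion.

    An edge of G costs one factor n because the lists have O(dn) entries altogether, not because
    they are short: a single list may have length close to n, which is what makes adjacency tests
    inside an edge loop expensive.

    Space stays constant because a product retains only the value of its first factor while the
    second is computed. Words suffice because every count is at most a power of n + 1 whose exponent
    depends on H alone. *)

Ltac slia := intros;
  repeat match goal with
  | H : is_true (leq _ _) |- _ => revert H
  | H : @eq nat _ _ |- _ => revert H
  end; clear; lia.

Section Elimination.
Variables (T : finType) (e : rel T).
Hypotheses (e_sym : symmetric e) (e_irr : irreflexive e).
Implicit Types (A B C D K X Y Z : {set T}) (u v w x y : T).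

(* [eliminable C t]: the extensions of a partial map to C can be counted in time
   O(n^t).  In [elim2] the loop runs over the O(n) edges of the host; the
   adjacency tests for w cost up to n more, hence the exponent t.+1. *)
Inductive eliminable : {set T} -> nat -> Prop :=
| elim0 t : eliminable set0 t
| elimU A B t : [disjoint A & B] -> (forall x y, x \in A -> y \in B -> ~~ e x y) ->
    eliminable A t -> eliminable B t -> eliminable (A :|: B) t
| elim1 v C t : v \in C -> eliminable (C :\ v) t -> eliminable C t.+1
| elim2 v w C t : v \in C -> w \in C -> e v w -> eliminable (C :\ v :\ w) t.+1 ->
    eliminable C t.+2.

Lemma elim_mono C t t' : t <= t' -> eliminable C t -> eliminable C t'.
Proof.
move=> le_tt' eC; elim: eC t' le_tt' => {C t}.
- by move=> t t' _; apply: elim0.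
- by move=> A B t dAB nAB _ IHA _ IHB t' le_tt'; apply: elimU; auto.
- move=> v C t Cv _ IH [|t'] // le_tt'; apply: (elim1 Cv); exact: IH.
- move=> v w C t Cv Cw evw _ IH [|[|t']] // le_tt'.
  by apply: (elim2 Cv Cw evw); apply: IH.
Qed.

(** * Degrees and edge counts of induced subgraphs *)

Definition deg C v := \sum_(u in C) e v u.
(** Twice the number of edges spanned by [C]; keeping the factor 2 avoids halving. *)
Definition vol C := \sum_(v in C) deg C v.

Lemma degS A B v : A \subset B -> deg A v <= deg B v.
Proof.
move=> sAB; rewrite /deg [X in _ <= X](big_setID A) /= (setIidPr sAB).
exact: leq_addr.
Qed.

Lemma degU1 A x v : x \notin A -> deg (x |: A) v = e v x + deg A v.
Proof. by move=> Ax; rewrite /deg big_setU1. Qed.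

Lemma degD1 A x v : x \in A -> deg A v = e v x + deg (A :\ x) v.
Proof. by move=> Ax; rewrite /deg (big_setD1 x). Qed.

Lemma deg_card A v : deg A v = #|[set u in A | e v u]|.
Proof.
rewrite /deg -big_mkcondr /= sum1_card.
by apply: eq_card => u; rewrite !inE.
Qed.

Lemma volU1 A x : x \notin A -> vol (x |: A) = vol A + 2 * deg A x.
Proof.
move=> Ax; rewrite /vol big_setU1 //= degU1 // e_irr add0n.
rewrite (eq_bigr (fun v => e v x + deg A v)); last by move=> v _; rewrite degU1.
rewrite big_split /=.
have -> : \sum_(v in A) e v x = deg A x by apply: eq_bigr => v _; rewrite e_sym.
slia.
Qed.

Lemma volD1 A x : x \in A -> vol A = vol (A :\ x) + 2 * deg A x.
Proof.
move=> Ax; rewrite -{1}(setD1K Ax) volU1 ?setD11 //.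
by rewrite (degD1 x Ax) e_irr.
Qed.

Lemma vol0 : vol set0 = 0.
Proof. by rewrite /vol big_set0. Qed.

Lemma vol1 x : vol [set x] = 0.
Proof. by rewrite /vol big_set1 /deg big_set1 e_irr. Qed.

Lemma deg_gt0 A x y : y \in A -> e x y -> 0 < deg A x.
Proof. by move=> Ay exy; rewrite (degD1 x Ay) exy. Qed.

Lemma sum_setU A B (F : T -> nat) : [disjoint A & B] ->
  \sum_(i in A :|: B) F i = \sum_(i in A) F i + \sum_(i in B) F i.
Proof.
by move=> dAB; rewrite -bigU //; apply: eq_bigl => i; rewrite !inE.
Qed.

Lemma vol_disjU A B : [disjoint A & B] ->
  vol (A :|: B) = vol A + vol B + 2 * \sum_(x in A) deg B x.
Proof.
move=> dAB; rewrite /vol sum_setU //.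
have degU v : deg (A :|: B) v = deg A v + deg B v by rewrite /deg sum_setU.
have sumU D : \sum_(v in D) deg (A :|: B) v = \sum_(v in D) deg A v + \sum_(v in D) deg B v.
  by rewrite -big_split; apply: eq_bigr => v _; rewrite degU.
rewrite !sumU.
have -> : \sum_(i in B) deg A i = \sum_(x in A) deg B x.
  rewrite /deg exchange_big /=; apply: eq_bigr => i _; apply: eq_bigr => j _.
  by rewrite e_sym.
slia.
Qed.

Lemma volD A B : [disjoint A & B] -> vol A + vol B <= vol (A :|: B).
Proof. by move=> dAB; rewrite vol_disjU // leq_addr. Qed.

Lemma vol_edgeU A B x y : [disjoint A & B] -> x \in A -> y \in B -> e x y ->
  vol A + vol B + 2 <= vol (A :|: B).
Proof.
move=> dAB Ax By exy; rewrite vol_disjU //.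
by have := deg_gt0 By exy; rewrite (bigD1 x) //=; slia.
Qed.

Lemma leq_vol A B : A \subset B -> vol A <= vol B.
Proof.
move=> sAB; rewrite -(setID B A) (setIidPr sAB).
apply: leq_trans (volD _); first exact: leq_addr.
by rewrite -setI_eq0 setIDA (setIC A) -setIDA setDv setI0.
Qed.

(** An edge between [X :\: Y] and [Y :\: X] is seen only by the union; all other edges count equally
    on both sides. *)
Lemma vol_supermod X Y : vol X + vol Y <= vol (X :|: Y) + vol (X :&: Y).
Proof.
have degIU v : deg X v + deg Y v = deg (X :|: Y) v + deg (X :&: Y) v.
  rewrite /deg ![\sum_(u in _) _]big_mkcond -!big_split /=.
  by apply: eq_bigr => u _; rewrite !inE; case: (u \in X); case: (u \in Y); rewrite /= ?addn0 // addnC.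
rewrite /vol ![\sum_(u in _) _]big_mkcond -!big_split /=.
apply: leq_sum => u _; rewrite !inE.
have := degIU u.
have := degS u (subsetUl X Y); have := degS u (subsetUr X Y).
by case: (u \in X); case: (u \in Y) => /=; slia.
Qed.

(** Connectivity through cuts rather than paths: the form in which sets are grown or split below.
    [set0] counts as connected. *)
Definition conn C := forall A, A \subset C -> A != set0 -> A != C ->
  exists x y, [/\ x \in A, y \in C, y \notin A & e x y].

Lemma conn_or_split C : conn C \/ exists A B,
  [/\ A :|: B = C, [disjoint A & B], (forall x y, x \in A -> y \in B -> ~~ e x y),
      #|A| < #|C| & #|B| < #|C|].
Proof.
case: (boolP [exists A : {set T}, [&& A \subset C, A != set0, A != C &
   [forall x in A, forall y in C, (y \notin A) ==> ~~ e x y]]]).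
  case/existsP=> A /and4P [sAC A0 AC /forall_inP nA]; right.
  exists A, (C :\: A); split.
  - by rewrite -{1}(setIidPr sAC) setID.
  - by rewrite -setI_eq0 setIDA (setIC A) -setIDA setDv setI0.
  - move=> x y Ax; rewrite inE => /andP [yA yC].
    by have /forall_inP/(_ y yC)/implyP := nA x Ax; apply.
  - by apply: proper_card; rewrite properEneq AC.
  - rewrite cardsD (setIidPr sAC); have := subset_leq_card sAC.
    by rewrite -card_gt0 in A0; slia.
move/existsPn=> nA; left=> A sAC A0 AC.
have := nA A; rewrite sAC A0 AC /= => /forall_inPn [x Ax /forall_inPn [y Cy]].
by rewrite negb_imply negbK => /andP [yA exy]; exists x, y.
Qed.

(** Growing [Y] to [C] by one boundary vertex at a time gains at least one edge, hence 2 in [vol],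
    per vertex. *)
Lemma vol_grow C Y : conn C -> Y \subset C -> Y != set0 ->
  vol Y + 2 * #|C| <= vol C + 2 * #|Y|.
Proof.
move=> cC; move: {2}(#|C| - #|Y|) (leqnn (#|C| - #|Y|)) => m.
elim: m Y => [|m IHm] Y le_m sYC Y0.
  have := subset_leq_card sYC => le_YC.
  by have /eqP -> : Y == C by rewrite eqEcard sYC /=; slia.
case: (eqVneq Y C) => [-> //|YC].
have [x [y [Yx Cy nYy exy]]] := cC Y sYC Y0 YC.
have sYyC : y |: Y \subset C by rewrite subUset sub1set Cy.
have := IHm (y |: Y); rewrite cardsU1 nYy volU1 // sYyC.
have := subset_leq_card sYyC; rewrite cardsU1 nYy.
have : 0 < deg Y y by apply: deg_gt0 Yx _; rewrite e_sym.
have -> : y |: Y != set0 by apply/set0Pn; exists y; rewrite setU11.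
move=> d0 cC1 IH; have /IH/(_ isT isT) : #|C| - (true + #|Y|) <= m by slia.
by slia.
Qed.

Lemma conn_vol C : conn C -> C != set0 -> 2 * #|C| <= vol C + 2.
Proof.
move=> cC /set0Pn [x Cx].
have := @vol_grow C [set x] cC; rewrite sub1set Cx vol1 cards1.
by move=> /(_ isT); apply; apply/set0Pn; exists x; rewrite set11.
Qed.

(** * Forests, defined by counting edges, and their centroid depth *)

Definition forest C := forall X, X \subset C -> X != set0 -> vol X < 2 * #|X|.

Lemma forestS A B : A \subset B -> forest B -> forest A.
Proof. by move=> sAB fB X sXA; apply: fB; apply: subset_trans sAB. Qed.

(* A forest with at most 2s + 2 vertices has an edge (or a vertex) whose deletion
   leaves components with at most s vertices. *)
Fixpoint tsize t := if t is t'.+1 then 2 * tsize t' + 2 else 1.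

Lemma forest_elim t C : forest C -> #|C| <= tsize t -> eliminable C t.+1.
Proof.
elim: t C => [|t IHt] C.
  move=> _ /=; rewrite leq_eqVlt ltnS leqn0 cards_eq0 => /orP [/cards1P [x ->]|/eqP ->].
    apply: (@elim1 x); first exact: set11.
    by rewrite setDv; apply: elim0.
  exact: elim0.
have [m] := ubnP #|C|; elim: m C => // m IHm C ltCm fC szC.
have [cC|[A [B [defC dAB nAB ltA ltB]]]] := conn_or_split C; last first.
  have sA : A \subset C by rewrite -defC subsetUl.
  have sB : B \subset C by rewrite -defC subsetUr.
  rewrite -defC; apply: elimU => //; apply: IHm.
  - slia.
  - exact: forestS fC.
  - slia.
  - slia.
  - exact: forestS fC.
  - slia.
case: (leqP #|C| (tsize t)) => [le_C|gt_C].
  by apply: elim_mono (IHt _ fC le_C).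
(* A branch has more than s = [tsize t] vertices and at most one edge, [w v], to the rest of [C].
   For a minimal branch [D], removing [w] leaves components of at most s vertices inside, while at
   most (2s + 2) - (s + 1) - 1 = s vertices remain outside once [v] is removed. *)
pose branch D := [&& D \subset C, tsize t < #|D| & [exists w in D, exists v,
  [forall x in D, forall y in C, (y \notin D) && e x y ==> (x == w) && (y == v)]]].
have brC : branch C.
  have /set0Pn [w Cw] : C != set0 by rewrite -card_gt0; slia.
  rewrite /branch subxx gt_C /=; apply/exists_inP; exists w => //.
  (* [C] has no edge leaving it within [C], so any vertex can stand for [v]. *)
  apply/existsP; exists w; apply/forall_inP => x Cx; apply/forall_inP => y Cy.
  by rewrite Cy.
case: (arg_minnP (fun D : {set T} => #|D|) brC) => D brD minD.
case/and3P: (brD) => sDC szD /exists_inP [w Dw /existsP [v /forall_inP brP]].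
have brE x y : x \in D -> y \in C -> y \notin D -> e x y -> x = w /\ y = v.
  move=> Dx Cy nDy exy; have /forall_inP/(_ y Cy) := brP x Dx.
  by rewrite nDy exy /= => /andP [/eqP-> /eqP->].
(* [X] is a union of components of [D :\ w]. A connected one with more than [tsize t] vertices has
   at most one edge to [w], by acyclicity, and so would be a smaller branch. *)
have inner X : X \subset D :\ w ->
    (forall x y, x \in X -> y \in D :\ w -> y \notin X -> ~~ e x y) -> eliminable X t.+1.
  have [i] := ubnP #|X|; elim: i X => // i IHi X ltXi sXD clX.
  have sXC : X \subset C by apply: subset_trans sXD _; apply: subset_trans (subD1set _ _) _.
  have [cX|[A [B [defX dAB nAB ltA ltB]]]] := conn_or_split X; last first.
    have sA : A \subset X by rewrite -defX subsetUl.
    have sB : B \subset X by rewrite -defX subsetUr.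
    rewrite -defX; apply: elimU => //; apply: IHi => //.
    - slia.
    - exact: subset_trans sXD.
    - move=> x y Ax Dy nAy; case: (boolP (y \in B)) => [By|nBy]; first exact: nAB.
      apply: clX => //; first exact: (subsetP sA).
      by rewrite -defX inE (negPf nAy).
    - slia.
    - exact: subset_trans sXD.
    - move=> x y Bx Dy nBy; case: (boolP (y \in A)) => [Ay|nAy].
        by rewrite e_sym; apply: nAB.
      apply: clX => //; first exact: (subsetP sB).
      by rewrite -defX inE (negPf nBy) orbF.
  case: (leqP #|X| (tsize t)) => [le_X|gt_X].
    by apply: IHt => //; apply: forestS fC.
  have wX : w \notin X by apply/negP=> /(subsetP sXD); rewrite setD11.
  have X0 : X != set0 by rewrite -card_gt0; slia.
  have degw : deg X w <= 1.
    have := conn_vol cX X0; have sXw : w |: X \subset C.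
      by rewrite subUset sub1set sXC (subsetP sDC).
    have := fC _ sXw; rewrite volU1 // cardsU1 wX.
    have -> : w |: X != set0 by apply/set0Pn; exists w; rewrite setU11.
    by move=> /(_ isT); slia.
  suff brX : branch X.
    have := minD X brX; have := subset_leq_card sXD.
    by rewrite (cardsD1 w D) Dw; slia.
  have [x0 Xx0 x0P] : exists2 x0, x0 \in X & forall x, x \in X -> e x w -> x = x0.
    case: (boolP [exists x in X, e w x]) => [/exists_inP [x0 Xx0 ewx0]|/exists_inPn nX].
      exists x0 => // x Xx exw; apply/eqP; rewrite -[_ == _]negbK; apply/negP=> xx0.
      have Xx' : x \in X :\ x0 by rewrite !inE xx0.
      have ewx : e w x by rewrite e_sym.
      by move: degw; rewrite (degD1 w Xx0) (degD1 w Xx') ewx0 ewx.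
    have /set0Pn [x0 Xx0] := X0; exists x0 => // x Xx; rewrite e_sym => exw.
    by have := nX x Xx; rewrite exw.
  rewrite /branch sXC gt_X /=; apply/exists_inP; exists x0 => //.
  apply/existsP; exists w; apply/forall_inP => x Xx; apply/forall_inP => y Cy.
  apply/implyP=> /andP [nXy exy].
  have Dx : x \in D by apply: (subsetP (subD1set D w)); apply: (subsetP sXD).
  have nxw : x != w by apply/eqP=> xw; rewrite xw (negPf wX) in Xx.
  case: (boolP (y \in D)) => [Dy|nDy].
    have yw : y = w.
      apply/eqP; rewrite -[_ == _]negbK; apply/negP=> nyw.
      have Dy' : y \in D :\ w by rewrite !inE nyw.
      by have := clX _ _ Xx Dy' nXy; rewrite exy.
    by rewrite yw eqxx andbT; apply/eqP/x0P => //; rewrite -yw.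
  by have [xw _] := brE x y Dx Cy nDy exy; rewrite xw eqxx in nxw.
have elD : eliminable (D :\ w) t.+1 by apply: inner => // x y Xx ->.
case: (eqVneq D C) => [DC|nDC].
  by rewrite DC in elD Dw; apply: (elim1 Dw).
have D0 : D != set0 by apply/set0Pn; exists w.
have [x [y [Dx Cy nDy exy]]] := cC D sDC D0 nDC.
have [xw yv] := brE x y Dx Cy nDy exy; subst x y.
have Cw := subsetP sDC w Dw.
apply: (@elim2 w v) => //.
have -> : C :\ w :\ v = (D :\ w) :|: (C :\: D :\ v).
  apply/setP=> z; rewrite !inE; case: (boolP (z \in D)) => [Dz|nDz] /=.
    rewrite (subsetP sDC z Dz) andbF orbF andbT.
    by case: eqVneq nDy => // <-; rewrite Dz.
  by rewrite andbF /=; case: (eqVneq z w) nDz => [->|]; rewrite ?Dw.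
apply: elimU => //.
- rewrite -setI_eq0; apply/eqP/setP=> z; rewrite !inE.
  by case: (z \in D); rewrite ?andbF.
- move=> x y; rewrite !inE => /andP [nxw Dx'] /and3P [nyv nDy' Cy'].
  apply/negP=> exy'; have [xw _] := brE x y Dx' Cy' nDy' exy'.
  by rewrite xw eqxx in nxw.
- apply: IHt; first by apply: forestS fC; apply: subset_trans (subD1set _ _) (subsetDl _ _).
  have := cardsD1 v (C :\: D); rewrite inE nDy Cy /=.
  have := cardsID D C; rewrite (setIidPr sDC).
  by move: szC => /=; slia.
Qed.


(** * Pseudoforests: at most one cycle per component *)

Definition pseudoforest C := forall X, X \subset C -> vol X <= 2 * #|X|.

(** Any vertex [w] of a minimal [X] with at least as many edges as vertices will do. Suppose [Y],
    avoiding [w], also has as many. If [Y] meets [X], supermodularity and the minimality of [X] give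
    [X :|: Y] too many edges. If not, grow [X] to a maximal such [B] disjoint from [Y]: an edge
    leaving [B] either enlarges [B] or joins it to [Y], and then [B :|: Y] has too many edges. *)
Lemma pseudoforest_delete C : conn C -> pseudoforest C -> ~ forest C ->
  exists2 w, w \in C & forest (C :\ w).
Proof.
move=> cC pC nfC.
pose P X := [&& X \subset C, X != set0 & 2 * #|X| <= vol X].
have [X0 PX0] : exists X, P X.
  case: (pickP P) => [X PX|nP]; first by exists X.
  case: nfC => X sXC X0; rewrite ltnNge; apply/negP=> vX.
  by have := nP X; rewrite /P sXC X0 vX.
case: (arg_minnP (fun D : {set T} => #|D|) PX0) => X /and3P [sXC nX0 vX] minX.
have /set0Pn [w Xw] := nX0.
exists w; first exact: (subsetP sXC).
move=> Y sYC nY0; rewrite ltnNge; apply/negP=> vY.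
have sYC' : Y \subset C by apply: subset_trans sYC (subD1set _ _).
have Yw : w \notin Y by apply/negP=> /(subsetP sYC); rewrite setD11.
have sU : X :|: Y \subset C by rewrite subUset sXC.
case: (eqVneq (X :&: Y) set0) => [XY0|nXY0]; last first.
  have ltXY : #|X :&: Y| < #|X|.
    by apply: proper_card; apply/properP; split; [apply: subsetIl | exists w; rewrite ?inE ?(negPf Yw) ?andbF].
  have : ~~ P (X :&: Y) by apply/negP=> /minX; rewrite leqNgt ltXY.
  rewrite /P nXY0 (subset_trans (subsetIl _ _) sXC) /= -ltnNge => vI.
  have := pC _ sU; have := vol_supermod X Y; have := cardsUI X Y.
  move: vX vY vI; clear; slia.
pose Q B := [&& X \subset B, B \subset C, [disjoint B & Y] & 2 * #|B| <= vol B].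
have QX : Q X by rewrite /Q subxx sXC vX -setI_eq0 XY0 eqxx.
case: (arg_maxnP (fun D : {set T} => #|D|) QX) => B /and4P [sXB sBC dBY vB] maxB.
have nB0 : B != set0 by apply/set0Pn; exists w; apply: (subsetP sXB).
have nBC : B != C.
  have /set0Pn [y Yy] := nY0; apply/eqP=> BC.
  by have := disjointFl dBY Yy; rewrite BC (subsetP sYC').
have [x [y [Bx Cy nBy exy]]] := cC B sBC nB0 nBC.
case: (boolP (y \in Y)) => [Yy|nYy].
  have := vol_edgeU dBY Bx Yy exy; have := pC (B :|: Y).
  rewrite subUset sBC sYC' => /(_ isT).
  have := cardsUI B Y; have /eqP -> : B :&: Y == set0 by rewrite setI_eq0.
  by rewrite cards0; move: vB vY; clear; slia.
have QB : Q (y |: B).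
  rewrite /Q (subset_trans sXB (subsetUr _ _)) subUset sub1set Cy sBC /=.
  rewrite -setI_eq0 setIUl setU_eq0 !setI_eq0 disjoints1 nYy dBY /=.
  rewrite cardsU1 nBy volU1 //=.
  by have := @deg_gt0 B y x Bx; rewrite e_sym exy => /(_ isT); slia.
by have := maxB _ QB; rewrite /= cardsU1 nBy; slia.
Qed.

(** The potential M; truncation makes isolated vertices contribute 0. *)
Definition excess C := \sum_(v in C) (deg C v).-1.

Lemma leq_excess A B : A \subset B -> excess A <= excess B.
Proof.
move=> sAB; rewrite /excess [X in _ <= X](big_setID A) /= (setIidPr sAB).
apply: leq_trans (leq_addr _ _); apply: leq_sum => v _.
by have := degS v sAB; slia.
Qed.

Lemma vol_le_excess C : vol C <= excess C + #|C|.
Proof.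
by rewrite -sum1_card -big_split; apply: leq_sum => v _ /=; slia.
Qed.

(** Equality holds for t = 0 and t = 1. The slope 6 is the drop of [excess] in [light_reduce]. *)
Lemma tsize_ge t : 6 * t + 4 <= tsize t.+1.
Proof. by elim: t => //= t; slia. Qed.

(** Let q be [excess C %/ 6]. With a cycle, [C] has at most [excess C] <= 6q + 5 vertices, and the
    6q + 4 left after one deletion fit in [tsize q.+1]. A tree has at most 6q + 7 vertices, which
    fit in [tsize q.+2]. Both give q + 3. *)
Lemma pseudoforest_elim C : conn C -> pseudoforest C -> eliminable C (excess C %/ 6 + 3).
Proof.
move=> cC pC; case: (eqVneq C set0) => [->|nC0]; first exact: elim0.
have eC := vol_le_excess C; have vC := conn_vol cC nC0.
case: (boolP [exists X : {set T}, [&& X \subset C, X != set0 & 2 * #|X| <= vol X]]).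
  case/existsP=> X /and3P [sXC X0 vX].
  have [|w Cw fC] := pseudoforest_delete cC pC.
    by move=> fC; have := fC X sXC X0; rewrite ltnNge vX.
  have vC2 := vol_grow cC sXC X0.
  rewrite addn3; apply: (elim1 Cw); apply: forest_elim => //.
  have := cardsD1 w C; rewrite Cw => cardC.
  have := tsize_ge (excess C %/ 6).
  have := divn_eq (excess C) 6; have := ltn_pmod (excess C) (isT : 0 < 6).
  slia.
move/existsPn=> nX.
have fC : forest C.
  by move=> X sXC X0; have := nX X; rewrite sXC X0 /= -ltnNge.
rewrite addn3; apply: forest_elim => //.
have := tsize_ge (excess C %/ 6).+1.
have := divn_eq (excess C) 6; have := ltn_pmod (excess C) (isT : 0 < 6).
slia.
Qed.


(* When no edge deletion removes five or more edges. *)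
Definition light C := forall x y, x \in C -> y \in C -> e x y -> deg C x + deg C y <= 5.

Lemma lightS A B : A \subset B -> light B -> light A.
Proof.
move=> sAB lB x y Ax Ay exy.
have := lB x y (subsetP sAB x Ax) (subsetP sAB y Ay) exy.
have := degS x sAB; have := degS y sAB; slia.
Qed.

(** Discharging: [g d] is 12 (d - 1) / d, the share of 12 (d - 1) put on each of the d edges at a
    vertex of degree d. An edge of degree sum at most 5 receives at most 14 from its two ends, the
    worst pair being (2, 3) with 6 + 8. *)
Lemma light_excess C : light C -> 12 * excess C <= 7 * vol C.
Proof.
move=> lC; pose g d := nth 0 [:: 0; 0; 6; 8; 9] d.
have gE x : x \in C -> 12 * (deg C x).-1 = \sum_(y in C) e x y * g (deg C x).
  move=> Cx; rewrite -big_distrl /= -/(deg C x).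
  have : deg C x <= 4.
    rewrite leqNgt; apply/negP=> gt4.
    have [y]: exists y, y \in [set u in C | e x u].
      by apply/set0Pn; rewrite -card_gt0 -deg_card; slia.
    rewrite inE => /andP [Cy exy]; have := lC x y Cx Cy exy.
    have : 0 < deg C y by apply: deg_gt0 Cx _; rewrite e_sym.
    slia.
  by case: (deg C x) => [|[|[|[|[|]]]]].
have gE1 : 12 * excess C = \sum_(x in C) \sum_(y in C) e x y * g (deg C x).
  by rewrite /excess big_distrr /=; apply: eq_bigr => x Cx; apply: gE.
have gE2 : 12 * excess C = \sum_(x in C) \sum_(y in C) e x y * g (deg C y).
  rewrite gE1 exchange_big /=; apply: eq_bigr => x _; apply: eq_bigr => y _.
  by rewrite e_sym.
suff : 12 * excess C + 12 * excess C <= 14 * vol C by slia.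
rewrite {1}gE1 gE2 -big_split /= /vol big_distrr /=; apply: leq_sum => x Cx.
rewrite -big_split /= /deg big_distrr /=; apply: leq_sum => y Cy.
case exy: (e x y); last by [].
have := lC x y Cx Cy exy; rewrite -/(deg C x) -/(deg C y) !mul1n muln1.
have : 0 < deg C x by apply: deg_gt0 Cy _.
have : 0 < deg C y by apply: deg_gt0 Cx _; rewrite e_sym.
rewrite /g; case: (deg C x) => [|[|[|[|[|a]]]]] //; case: (deg C y) => [|[|[|[|[|b]]]]] //;
  by move=> *; slia.
Qed.

(** The drop of 6 is made up of 2 for [v] (degree 3), 1 for its neighbour [w] (degree 2), and at
    least 1 for each of three vertices of degree at least 2 that lose a neighbour: the two other
    neighbours of [v] and the second neighbour of [w]. These three are distinct when the last one is
    not adjacent to [v], which dictates the choice of [w]. *)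
Lemma light_reduce C : light C -> ~ pseudoforest C -> exists v w,
  [/\ v \in C, w \in C, e v w & excess (C :\ v :\ w) + 6 <= excess C].
Proof.
move=> lC npC.
pose P X := (X \subset C) && (2 * #|X| < vol X).
have [X0 PX0] : exists X, P X.
  case: (pickP P) => [X PX|nP]; first by exists X.
  case: npC => X sXC; rewrite leqNgt; apply/negP=> vX.
  by have := nP X; rewrite /P sXC vX.
case: (arg_minnP (fun D : {set T} => #|D|) PX0) => K /andP [sKC vK] minK.
(* Dropping a vertex of degree at most 1 would leave a smaller set with more edges than vertices. *)
have degK x : x \in K -> 2 <= deg K x.
  move=> Kx; rewrite ltnNge; apply/negP=> le1.
  have := volD1 Kx; have := cardsD1 x K; rewrite Kx => cK vK'.
  have := minK (K :\ x); rewrite /P (subset_trans (subD1set _ _) sKC) /=.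
  by case: ltnP => [_ /(_ isT)|? _]; slia.
have degCK x : x \in K -> 2 <= deg C x.
  by move=> Kx; apply: leq_trans (degK x Kx) (degS _ sKC).
have [v Kv deg3] : exists2 v, v \in K & 3 <= deg K v.
  apply/exists_inP; rewrite -[X in is_true X]negbK negb_exists_in.
  apply/negP=> /forall_inP all2; move: vK; rewrite ltnNge => /negP; apply.
  rewrite mulnC -sum_nat_const; by apply: leq_sum => x /all2; rewrite -leqNgt.
have Cv := subsetP sKC v Kv.
(* Degrees at least 2 and 3 with sum at most 5 leave no choice. *)
have nbv u : u \in K -> e v u -> deg C u = 2 /\ deg C v = 3.
  move=> Ku evu; have Cu := subsetP sKC u Ku; have := lC v u Cv Cu evu.
  by have := degCK u Ku; have := degS v sKC; slia.
(* The degree of [v] in [C] is 3, and [K] alone already provides it. *)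
have nbK u : u \in C -> e v u -> u \in K.
  move=> Cu evu; rewrite -[_ \in _]negbK; apply/negP=> nKu.
  have sKu : u |: K \subset C by rewrite subUset sub1set Cu.
  have [u' ] : exists u', u' \in [set z in K | e v z].
    by apply/set0Pn; rewrite -card_gt0 -deg_card; slia.
  rewrite inE => /andP [Ku' evu']; have [_ dv] := nbv u' Ku' evu'.
  by have := degS v sKu; rewrite degU1 // evu; slia.
pose N := [set u in C | e v u].
have [u0 Nu0] : exists u, u \in N.
  by apply/set0Pn; rewrite -card_gt0 -deg_card; have := degS v sKC; slia.
have NE u : u \in N -> [/\ u \in C, u \in K, e v u & deg C u = 2].
  by rewrite inE => /andP [Cu evu]; have Ku := nbK u Cu evu; have [] := nbv u Ku evu.
have cardN : #|N| = 3.
  by rewrite -deg_card; have [Cu Ku evu _] := NE _ Nu0; have [] := nbv _ Ku evu.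
have nvv : v \notin N by rewrite inE e_irr andbF.
(* Each neighbour of v has one further neighbour; as |N| = 3 is odd, these
   cannot pair up N internally. *)
have other a : a \in N -> exists2 z, z \in K :\ v & e a z /\ forall y, y \in C -> e a y -> y = v \/ y = z.
  move=> Na; have [Ca Ka eva d2] := NE a Na.
  have dK := degK a Ka; have eav : e a v by rewrite e_sym.
  have := dK; rewrite (degD1 a Kv) eav => dK1.
  have [z] : exists z, z \in [set z in K :\ v | e a z].
    by apply/set0Pn; rewrite -card_gt0 -deg_card; slia.
  rewrite inE => /andP [Kz eaz]; exists z => //; split=> // y Cy eay.
  case: (eqVneq y v) => [|nyv]; first by left.
  right; apply/eqP; rewrite -[_ == _]negbK; apply/negP=> nyz.
  move: Kz; rewrite !inE => /andP [nzv Kz]; have Cz := subsetP sKC z Kz.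
  have Cz1 : z \in C :\ v by rewrite !inE nzv.
  have Cy1 : y \in C :\ v :\ z by rewrite !inE nyz nyv.
  by move: d2; rewrite (degD1 a Cv) (degD1 a Cz1) (degD1 a Cy1) eav eaz eay.
have [a Na [z Kz [eaz nNz]]] : exists2 a, a \in N & exists2 z, z \in K :\ v & e a z /\ z \notin N.
  have [z Kz [euz uP]] := other u0 Nu0.
  case: (boolP (z \in N)) => [Nz|nNz]; last by exists u0 => //; exists z.
  have nzu : z != u0 by apply/eqP=> zu; rewrite zu e_irr in euz.
  have [b Nb] : exists b, b \in N :\ u0 :\ z.
    apply/set0Pn; rewrite -card_gt0; have := cardsD1 u0 N.
    by have := cardsD1 z (N :\ u0); rewrite Nu0 !inE nzu; move: Nz; rewrite inE => ->; slia.
  move: Nb; rewrite !in_setD1 => /and3P [nbz nbu Nb].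
  have [z' Kz' [ebz' bP]] := other b Nb; exists b => //; exists z' => //; split=> //.
  apply/negP=> Nz'; have [Cb _ _ _] := NE b Nb.
  have nbv' : b != v by apply: contraNneq nvv => <-.
  have nu0v : u0 != v by apply: contraNneq nvv => <-.
  have [y Ky [ezy zP]] := other z Nz.
  have [Cu0 _ _ _] := NE _ Nu0.
  have yu : u0 = y by have [] := zP u0 Cu0 _; rewrite ?(e_sym z) // => /eqP; rewrite (negPf nu0v).
  case: (eqVneq z' u0) => [zu|nzu'].
    have [] := uP b Cb; first by rewrite e_sym -zu.
      by move/eqP; rewrite (negPf nbv').
    by move/eqP; rewrite (negPf nbz).
  case: (eqVneq z' z) => [zz|nzz'].
    have [] := zP b Cb; first by rewrite e_sym -zz.
      by move/eqP; rewrite (negPf nbv').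
    by rewrite -yu => /eqP; rewrite (negPf nbu).
  have Nz2 : z' \in N :\ u0 :\ z by rewrite !in_setD1 nzz' nzu'.
  have Nb2 : b \in N :\ u0 :\ z by rewrite !in_setD1 nbz nbu.
  have c1 : #|N :\ u0 :\ z| <= 1.
    have := cardsD1 u0 N; have := cardsD1 z (N :\ u0).
    by rewrite Nu0 in_setD1 nzu Nz cardN; slia.
  have bz : b = z' by apply: (card_le1_eqP c1).
  by rewrite bz e_irr in ebz'.
have [Ca Ka eva da] := NE a Na.
have [nzv Kz'] : z != v /\ z \in K by move: Kz; rewrite !inE => /andP [].
have Cz := subsetP sKC z Kz'.
have nav : a != v by apply: contraNneq nvv => <-.
have nza : z != a by apply: contraNneq nNz => ->.
exists v, a; split=> //.
have dv : deg C v = 3 by have [] := nbv a Ka eva.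
pose Z := z |: N :\ a; pose R := C :\ v :\ a.
have sZR : Z \subset R.
  apply/subsetP=> x; rewrite !inE => /orP [/eqP->|]; first by rewrite nza nzv.
  by case/and3P => -> -> evx; rewrite andbT; apply: contraTneq evx => ->; rewrite e_irr.
have cZ : #|Z| = 3.
  have := cardsD1 a N; rewrite Na cardN cardsU1 in_setD1 (negPf nNz) andbF /=; slia.
have Zdrop x : x \in Z -> deg R x < deg C x /\ 2 <= deg C x.
  have CaV : a \in C :\ v by rewrite !inE nav.
  have := degD1 x Cv; have := degD1 x CaV; rewrite -/R in_setU1 => dR dC.
  case/orP=> [/eqP xz|].
    by have := degCK z Kz'; move: dR; rewrite xz (e_sym z a) eaz -xz => dR; split; slia.
  rewrite in_setD1 => /andP [_ Nx]; have [_ _ evx d2] := NE x Nx.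
  by move: dC; rewrite (e_sym x v) evx => dC; split; slia.
have -> : excess C = 3 + \sum_(x in R) (deg C x).-1.
  have CaV : a \in C :\ v by rewrite !inE nav.
  by rewrite /excess (big_setD1 v) //= (big_setD1 a) //= dv da.
rewrite -/R.
have : excess R + #|Z| <= \sum_(x in R) (deg C x).-1.
  have -> : #|Z| = \sum_(x in R) (x \in Z).
    rewrite -big_mkcondr /= sum1_card; apply: eq_card => x; rewrite !unfold_in.
    by apply/idP/andP => [Zx|[]//]; split=> //; apply: (subsetP sZR).
  rewrite /excess -big_split; apply: leq_sum => x _ /=.
  case: (boolP (x \in Z)) => [/Zdrop [lt ge2]|_]; first by slia.
  by have := degS x (subset_trans (subD1set (C :\ v) a) (subD1set C v)); rewrite -/R; slia.
by rewrite cZ; slia.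
Qed.

Lemma light_elim C : light C -> eliminable C (excess C %/ 6 + 3).
Proof.
have [m] := ubnP #|C|; elim: m C => // m IHm C ltCm lC.
case: (boolP [forall X : {set T}, (X \subset C) ==> (vol X <= 2 * #|X|)]); last first.
  move/forallPn=> [X]; rewrite negb_imply => /andP [sXC vX].
  have [|v [w [Cv Cw evw ex]]] := light_reduce lC.
    by move=> pC; have := pC X sXC; rewrite (negPf vX).
  have sD : C :\ v :\ w \subset C by apply: subset_trans (subD1set _ _) (subD1set _ _).
  have ltD : #|C :\ v :\ w| < m.
    by have := cardsD1 v C; have := subset_leq_card (subD1set (C :\ v) w); rewrite Cv; slia.
  have eD := IHm _ ltD (lightS sD lC).
  (* [elim2] wants an exponent of the form [t.+2], which the additive 3 always provides. *)
  have -> : excess C %/ 6 + 3 = (excess C %/ 6 + 1).+2 by slia.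
  apply: (elim2 Cv Cw evw); apply: elim_mono eD.
  have : (excess (C :\ v :\ w) + 6) %/ 6 <= excess C %/ 6 by apply: leq_div2r.
  by rewrite divnDr // divnn /=; slia.
move/forall_inP=> pC.
have [cC|[A [B [defC dAB nAB ltA ltB]]]] := conn_or_split C.
  exact: pseudoforest_elim.
have sA : A \subset C by rewrite -defC subsetUl.
have sB : B \subset C by rewrite -defC subsetUr.
rewrite -{1}defC; apply: elimU => //.
  have eA := IHm A _ (lightS sA lC); apply: elim_mono (eA _); last by slia.
  by rewrite leq_add2r leq_div2r // leq_excess.
have eB := IHm B _ (lightS sB lC); apply: elim_mono (eB _); last by slia.
by rewrite leq_add2r leq_div2r // leq_excess.
Qed.

(** The edge between the two deleted vertices is counted in both degrees, so a degree sum of 6 means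
    5 edges, or 10 in [vol]. In the light case [excess C] / 6 <= 7 [vol C] / 72 <= [vol C] / 10. *)
Lemma vol_elim C : eliminable C (vol C %/ 10 + 3).
Proof.
have [m] := ubnP #|C|; elim: m C => // m IHm C ltCm.
case: (boolP [exists v in C, exists w in C, e v w && (6 <= deg C v + deg C w)]).
  case/exists_inP=> v Cv /exists_inP [w Cw /andP [evw dvw]].
  have wv : w != v by apply: contraTneq evw => ->; rewrite e_irr.
  have Cw' : w \in C :\ v by rewrite !inE wv.
  have ltD : #|C :\ v :\ w| < m.
    by have := cardsD1 v C; have := subset_leq_card (subD1set (C :\ v) w); rewrite Cv; slia.
  have -> : vol C %/ 10 + 3 = (vol C %/ 10 + 1).+2 by slia.
  apply: (elim2 Cv Cw evw); apply: elim_mono (IHm _ ltD).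
  have : (vol (C :\ v :\ w) + 10) %/ 10 <= vol C %/ 10.
    apply: leq_div2r; rewrite (volD1 Cv) (volD1 Cw').
    by move: dvw; rewrite (degD1 w Cv) e_sym evw; slia.
  by rewrite divnDr // divnn /=; slia.
move/exists_inPn=> nbig.
have lC : light C.
  move=> x y Cx Cy exy; have /exists_inPn/(_ y Cy) := nbig x Cx.
  by rewrite exy /= -ltnNge; slia.
apply: elim_mono (light_elim lC).
rewrite leq_add2r leq_divRL //; have := light_excess lC.
have := leq_divM (excess C) 6; slia.
Qed.

End Elimination.

(** * A structured language over the RAM *)

Definition upd (T : Type) (m : nat -> T) (x : nat) (v : T) : nat -> T :=
  fun a => if a == x then v else m a.

Inductive bop := OAdd | OSub | OMul | ODiv.

Definition bop_fun o : nat -> nat -> nat :=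
  match o with OAdd => addn | OSub => subn | OMul => muln | ODiv => divn end.

Definition bop_instr o : nat -> nat -> nat -> instr :=
  match o with OAdd => IAdd | OSub => ISub | OMul => IMul | ODiv => IDiv end.

Inductive expr :=
| Var of nat
| Cst of nat
| Rd of expr
| Bin of bop & expr & expr.

(** No conditional: tests are 0/1 values used as factors. *)
Inductive stmt :=
| Asg of nat & expr
| Seq of stmt & stmt
| While of nat & stmt.

Fixpoint eval (inp : seq nat) (s : nat -> nat) e :=
  match e with
  | Var x => s x
  | Cst c => c
  | Rd a => nth 0 inp (eval inp s a)
  | Bin o a b => bop_fun o (eval inp s a) (eval inp s b)
  end.

(** All intermediate values are bounded, since the machine crashes on any value above [W]. *)
Fixpoint fits (W : nat) inp s e :=
  (eval inp s e <= W) &&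
  match e with
  | Var _ | Cst _ => true
  | Rd a => fits W inp s a
  | Bin _ a b => fits W inp s a && fits W inp s b
  end.

(** Both the length and the running time of the compiled code, which is straight-line. A variable
    costs 2 because the machine has no move: copying is adding 0. *)
Fixpoint ecost e :=
  match e with
  | Var _ => 2
  | Cst _ => 1
  | Rd a => (ecost a).+1
  | Bin _ a b => (ecost a + ecost b).+1
  end.

(* [t] receives the value; only registers from [t] on are written. *)
Fixpoint ecomp e t : seq instr :=
  match e with
  | Var x => [:: IConst t 0; IAdd t x t]
  | Cst c => [:: IConst t c]
  | Rd a => ecomp a t ++ [:: IRead t t]
  | Bin o a b => ecomp a t ++ ecomp b t.+1 ++ [:: bop_instr o t t t.+1]
  end.

Fixpoint escope K e :=
  match e with
  | Var x => x < K
  | Cst _ => true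
  | Rd a => escope K a
  | Bin _ a b => escope K a && escope K b
  end.

(** Code length only; the machine steps of a run are the last argument of [ev]. *)
Fixpoint scost s :=
  match s with
  | Asg _ e => ecost e + 2
  | Seq s1 s2 => scost s1 + scost s2
  | While _ s => scost s + 2
  end.

(** Jump targets are absolute, hence the address [b] of the code. Variables live in registers below
    [K], temporaries from [K] on. *)
Fixpoint scomp K s b : seq instr :=
  match s with
  | Asg x e => ecomp e K ++ [:: IConst K.+1 0; IAdd x K K.+1]
  | Seq s1 s2 => scomp K s1 b ++ scomp K s2 (b + scost s1)
  | While x s => IJz x (b + scost s + 2) :: scomp K s b.+1 ++ [:: IJmp b]
  end.

Fixpoint sscope K s :=
  match s with
  | Asg x e => (x < K) && escope K e
  | Seq s1 s2 => sscope K s1 && sscope K s2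
  | While x s => (x < K) && sscope K s
  end.

Section Run.
Variables (W : nat) (inp : seq nat).

Inductive ev : stmt -> (nat -> nat) -> (nat -> nat) -> nat -> Prop :=
| evAsg x e s : fits W inp s e ->
    ev (Asg x e) s (upd s x (eval inp s e)) (ecost e + 2)
| evSeq s1 s2 s s' s'' t1 t2 : ev s1 s s' t1 -> ev s2 s' s'' t2 ->
    ev (Seq s1 s2) s s'' (t1 + t2)
| evWhile0 x c s : s x = 0 -> ev (While x c) s s 1
| evWhileS x c s s' s'' t1 t2 : s x != 0 -> ev c s s' t1 ->
    ev (While x c) s' s'' t2 -> ev (While x c) s s'' (t1 + t2 + 2).

Lemma size_ecomp e t : size (ecomp e t) = ecost e.
Proof.
by elim: e t => //= [e IH|o a IHa b IHb] t; rewrite !size_cat ?IH ?IHa ?IHb /=; lia.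
Qed.

Lemma ecost_gt0 e : 0 < ecost e.
Proof. by case: e. Qed.

Lemma size_scomp K s b : size (scomp K s b) = scost s.
Proof.
elim: s b => //= [x e|s1 IH1 s2 IH2|x s IH] b.
- by rewrite size_cat size_ecomp.
- by rewrite size_cat IH1 IH2.
- by rewrite size_cat IH /= addn1 addn2.
Qed.

Variables (S : nat) (P : seq instr).

Definition code_at b c := exists pre post, P = pre ++ c ++ post /\ size pre = b.

Lemma code_at_cat b c1 c2 : code_at b (c1 ++ c2) ->
  code_at b c1 /\ code_at (b + size c1) c2.
Proof.
case=> pre [post [defP <-]]; split.
  by exists pre, (c2 ++ post); rewrite defP -!catA.
by exists (pre ++ c1), post; rewrite size_cat defP -!catA.
Qed.

Lemma code_at_cons b i c : code_at b (i :: c) ->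
  [/\ b < size P, nth IHalt P b = i & code_at b.+1 c].
Proof.
case=> pre [post [defP <-]]; split.
- by rewrite defP size_cat /= addnS ltnS leq_addr.
- by rewrite defP nth_cat ltnn subnn.
- by exists (rcons pre i), post; rewrite size_rcons cat_rcons.
Qed.

Local Notation exec := (exec S W inp P).

Local Arguments Defs.exec : simpl never.

Lemma execS f st : exec f.+1 st =
  match step S W inp P st with
  | Crash => None | Halted o => Some o | Next st' => exec f st'
  end.
Proof. by []. Qed.

(** The frame condition below [t] protects a left operand, held in [t], while the right one is
    evaluated from [t.+1]. The spare fuel [f] lets runs be chained. *)
Lemma ecomp_sim e t K b m s f : fits W inp s e -> escope K e -> K <= t ->
  t + ecost e <= S -> (forall a, a < K -> m a = s a) -> code_at b (ecomp e t) ->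
  exists m', [/\ forall a, a < t -> m' a = m a, m' t = eval inp s e &
    exec (ecost e + f) (State b m) = exec f (State (b + ecost e) m')].
Proof.
elim: e t b m f => [x|c|e IHe|o e1 IH1 e2 IH2] t b m f /=.
- rewrite andbT => fx xK Kt tS agr /code_at_cons [bP nb /code_at_cons [bP1 nb1 _]].
  exists (upd (upd m t 0) t (m x + 0)); split.
  + by move=> a ltat; rewrite /upd (ltn_eqF ltat).
  + by rewrite /upd eqxx addn0 agr.
    have tS1 : t < S by lia.
    have xS1 : x < S by lia.
    rewrite add2n !execS /step /= bP nb tS1 /= execS /step /= bP1 nb1 /= tS1 xS1 (ltn_eqF (leq_trans xK Kt)).
    by rewrite eqxx addn0 agr // fx addn2.
- rewrite andbT => fc _ Kt tS agr /code_at_cons [bP nb _].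
  exists (upd m t c); split.
  + by move=> a ltat; rewrite /upd (ltn_eqF ltat).
  + by rewrite /upd eqxx.
  + have tS1 : t < S by lia.
    by rewrite add1n execS /step /= bP nb tS1 fc addn1.
- move=> /andP [fr fe] eK Kt tS agr /code_at_cat [c1 /code_at_cons [bP nb _]].
  have [|m1 [m1t m1e ex1]] := IHe t b m f.+1 fe eK Kt _ agr c1; first by lia.
  exists (upd m1 t (eval inp s (Rd e))); split.
  + by move=> a ltat; rewrite /upd (ltn_eqF ltat) m1t.
  + by rewrite /upd eqxx.
  + rewrite addSnnS ex1 addnS; move: bP nb; rewrite size_ecomp => bP nb.
    have tS1 : t < S by lia.
    by rewrite execS /step /= bP nb m1e tS1 fr.
- move=> /andP [fo /andP [f1 f2]] /andP [e1K e2K] Kt tS agr.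
  case/code_at_cat=> c1 /code_at_cat [c2 /code_at_cons [bP nb _]].
  have [|m1 [m1t m1e ex1]] := IH1 t b m (ecost e2 + f.+1) f1 e1K Kt _ agr c1; first by lia.
  rewrite size_ecomp in c2.
  have agr1 a : a < K -> m1 a = s a by move=> aK; rewrite m1t ?agr //; lia.
  have [||m2 [m2t m2e ex2]] := IH2 t.+1 _ m1 f.+1 f2 e2K _ _ agr1 c2; first by lia.
    by lia.
  exists (upd m2 t (eval inp s (Bin o e1 e2))); split.
  + by move=> a ltat; rewrite /upd (ltn_eqF ltat) m2t ?m1t //; lia.
  + by rewrite /upd eqxx.
  + have -> : (ecost e1 + ecost e2).+1 + f = ecost e1 + (ecost e2 + f.+1) by lia.
    rewrite ex1 ex2; move: bP nb; rewrite !size_ecomp => bP nb.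
    rewrite execS /step /= bP nb.
    have tS1 : t < S by lia.
    have t1S : t.+1 < S by have := ecost_gt0 e2; lia.
    have m2t' : m2 t = eval inp s e1 by rewrite m2t // m1e.
    by case: o fo {nb} => /= fo; rewrite tS1 t1S m2t' m2e fo /= addnS addnA.
Qed.

(** By induction on the evaluation rather than on the program, as a [While] re-enters its own
    code. *)
Lemma scomp_sim K c s s' t b m f : ev c s s' t -> sscope K c ->
  K + scost c <= S -> (forall a, a < K -> m a = s a) -> code_at b (scomp K c b) ->
  exists m', (forall a, a < K -> m' a = s' a) /\
    exec (t + f) (State b m) = exec f (State (b + scost c) m').
Proof.
move=> evc; elim: evc b m f => {c s s' t}.
- move=> x e s fe b m f /= /andP [xK eK] leS agr /code_at_cat [c1 c2].
  have [|m1 [m1t m1e ex1]] := ecomp_sim f.+2 fe eK (leqnn K) _ agr c1; first by lia.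
  rewrite size_ecomp in c2.
  case/code_at_cons: c2 => bP nb /code_at_cons [bP1 nb1 _].
  exists (upd (upd m1 K.+1 0) x (eval inp s e)); split.
    move=> a aK; rewrite /upd; case: eqP => // _.
    by rewrite ltn_eqF ?m1t ?agr //; lia.
  rewrite -addnA add2n ex1 !execS /step /= bP nb.
  have KS : K < S by lia.
  have K1S : K.+1 < S by have := ecost_gt0 e; lia.
  have xS : x < S by lia.
  have eW : eval inp s e <= W by case: (e) fe => /= [?|?|?|???] /andP [].
  rewrite K1S /= execS /step /= bP1 nb1 /= KS K1S xS (ltn_eqF (ltnSn K)) eqxx m1e addn0 eW /=.
  by rewrite addnA addn2.
- move=> s1 s2 s s' s'' t1 t2 _ IH1 _ IH2 b m f /= /andP [k1 k2] leS agr.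
  case/code_at_cat=> c1; rewrite size_scomp => c2.
  have [|m1 [agr1 ex1]] := IH1 b m (t2 + f) k1 _ agr c1; first by lia.
  have [|m2 [agr2 ex2]] := IH2 _ m1 f k2 _ agr1 c2; first by lia.
  by exists m2; split=> //; rewrite -addnA ex1 ex2 addnA.
- move=> x c s s0 b m f /= /andP [xK ck] leS agr /code_at_cons [bP nb _].
  exists m; split=> //; have xS : x < S by lia.
  by rewrite add1n execS /step /= bP nb xS agr // s0 eqxx -addnA.
- move=> x c s s' s'' t1 t2 s0 _ IH1 _ IH2 b m f /= /andP [xK ck] leS agr co.
  have [bP nb /code_at_cat [c1]] := code_at_cons co.
  rewrite size_scomp => /code_at_cons [bP1 nb1 _].
  have [|m1 [agr1 ex1]] := IH1 b.+1 m (t2 + f).+1 ck _ agr c1; first by lia.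
  have [|m2 [agr2 ex2]] := IH2 b m1 f _ leS agr1 co; first by rewrite /= xK.
  exists m2; split=> //; have xS : x < S by lia.
  have -> : t1 + t2 + 2 + f = (t1 + (t2 + f).+1).+1 by lia.
  rewrite execS /step /= bP nb xS agr // (negPf s0) ex1.
  by rewrite execS /step /= bP1 nb1 ex2.
Qed.

End Run.

Lemma run_scomp W S T inp c s t K : ev W inp c (fun _ => 0) s t -> sscope K c ->
  0 < K -> K + scost c <= S -> t < T ->
  run S W inp (scomp K c 0 ++ [:: IHalt]) T = Some (s 0).
Proof.
move=> evc ck K0 leS ltT; set P := _ ++ _.
have [|m [agr ex]] := @scomp_sim W inp S P K c _ s t 0 (fun _ => 0) (T - t) evc ck leS (fun _ _ => erefl).
  by exists [::], [:: IHalt].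
rewrite /run /init_state -(subnKC (ltnW ltT)) ex add0n.
(* The fuel left over is positive and pays for [IHalt]. *)
have -> : T - t = (T - t).-1.+1 by lia.
rewrite execS /step /=.
rewrite /P size_cat size_scomp /= addn1 ltnSn nth_cat size_scomp ltnn subnn /=.
have -> : 0 < S by lia.
by rewrite agr.
Qed.

(** * Counting plans *)

Lemma upd_eq (T : Type) (s : nat -> T) x v : upd s x v x = v.
Proof. by rewrite /upd eqxx. Qed.

Lemma upd_ne (T : Type) (s : nat -> T) x v a : a <> x -> upd s x v a = s a.
Proof. by rewrite /upd => /eqP/negPf ->. Qed.

Ltac upds := repeat match goal with
  | |- context [upd ?s ?x ?v ?a] =>
    first [ rewrite (@upd_eq _ s x v) | rewrite (@upd_ne _ s x v a); [| lia] ]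
  end.

Lemma sum_ordS (F : nat -> nat) n : \sum_(i < n.+1) F i = \sum_(i < n) F i + F n.
Proof. by rewrite big_ord_recr. Qed.

(** * Hoare triples with a time bound *)

Section Spec.
Variables (W : nat) (inp : seq nat).

Definition spec c s t (Q : (nat -> nat) -> Prop) :=
  exists s' t', [/\ t' <= t, ev W inp c s s' t' & Q s'].

Lemma spec_weak c s t t' (Q Q' : (nat -> nat) -> Prop) :
  spec c s t Q -> t <= t' -> (forall s', Q s' -> Q' s') -> spec c s t' Q'.
Proof.
case=> s' [t1 [le1 ev1 Qs']] le_tt' QQ'; exists s', t1; split; last exact: QQ'.
  exact: leq_trans le_tt'.
by [].
Qed.

Lemma spec_asg x e s t (Q : _ -> Prop) : fits W inp s e -> ecost e + 2 <= t ->
  Q (upd s x (eval inp s e)) -> spec (Asg x e) s t Q.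
Proof.
by move=> fe let_ Qs; exists (upd s x (eval inp s e)), (ecost e + 2); split=> //; apply: evAsg.
Qed.

Lemma spec_seq c1 c2 s t1 t2 t Q : spec c1 s t1 (fun s' => spec c2 s' t2 Q) ->
  t1 + t2 <= t -> spec (Seq c1 c2) s t Q.
Proof.
case=> s1 [u1 [le1 ev1 [s2 [u2 [le2 ev2 Qs2]]]]] le_t.
by exists s2, (u1 + u2); split=> //; [lia | apply: evSeq ev1 ev2].
Qed.

(** Counting down needs no register for the bound; the round with counter [i.+1] treats index
    [i]. *)
Definition loop x c := While x (Seq c (Asg x (Bin OSub (Var x) (Cst 1)))).

(** The body may assume that its partial sum does not exceed the final one; this keeps the
    accumulator [r] within a word. *)
Lemma spec_loop x r c s N (F T : nat -> nat) (I : (nat -> nat) -> Prop)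
    (Q : (nat -> nat) -> Prop) t :
  s x = N -> N < W -> x <> r -> I s ->
  (forall s1 v, I s1 -> I (upd s1 x v)) ->
  (forall i s1, i < N -> I s1 -> s1 x = i.+1 ->
     s1 r + F i <= s r + \sum_(j < N) F j ->
     spec c s1 (T i) (fun s2 => [/\ I s2, s2 x = i.+1 & s2 r = s1 r + F i])) ->
  (forall s', I s' -> s' r = s r + \sum_(j < N) F j -> Q s') ->
  \sum_(j < N) (T j + 8) + 1 <= t ->
  spec (loop x c) s t Q.
Proof.
move=> sx NW xr Is Iupd body QI le_t.
(* With [M] rounds left, what is accumulated plus what is outstanding equals the final value. *)
suff H M s1 : M <= N -> I s1 -> s1 x = M ->
    s1 r + \sum_(j < M) F j = s r + \sum_(j < N) F j ->
    spec (loop x c) s1 (\sum_(j < M) (T j + 8) + 1) Q.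
  by apply: spec_weak (H N s _ Is sx _) le_t _.
elim: M s1 => [|M IH] s1 leM Is1 s1x sum1.
  exists s1, 1; rewrite big_ord0; split=> //; first exact: evWhile0.
  by apply: QI; rewrite // -sum1 big_ord0 addn0.
move: sum1; rewrite !(sum_ordS (fun j => T j + 8)) !sum_ordS => sum1.
have [|s2 [t2 [le2 ev2 [Is2 s2x s2r]]]] := body M s1 leM Is1 s1x.
  by rewrite -sum1; lia.
have [||||s3 [t3 [le3 ev3 Qs3]]] := IH (upd s2 x M).
- by lia.
- exact: Iupd.
- by rewrite upd_eq.
- by rewrite upd_ne ?s2r; lia.
exists s3, (t2 + 6 + t3 + 2); split=> //; first by lia.
apply: evWhileS ev3; first by rewrite s1x.
apply: evSeq ev2 _.
have -> : upd s2 x M = upd s2 x (eval inp s2 (Bin OSub (Var x) (Cst 1))).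
  by rewrite /= s2x subn1.
by apply: evAsg; rewrite /= s2x; lia.
Qed.

End Spec.

(** * Host graphs as seen by a program *)

Record host := Host { hn : nat; hadj : nat -> seq nat }.

(** Offsets start at index 1 of the input, so the list of [x] lies between the positions read at
    [x + 1] and [x + 2]. [enc_small] makes every read fit in a word. *)
Record encodes (h : host) (inp : seq nat) : Prop := Encodes {
  enc_n : nth 0 inp 0 = hn h;
  enc_deg : forall x, x < hn h -> nth 0 inp (x + 2) = nth 0 inp (x + 1) + size (hadj h x);
  enc_nbr : forall x i, x < hn h -> i < size (hadj h x) ->
    nth 0 inp (nth 0 inp (x + 1) + i) = nth 0 (hadj h x) i;
  enc_small : forall i, nth 0 inp i <= (hn h).+2 ^ 2;
  enc_uniq : forall x, x < hn h -> uniq (hadj h x);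
  enc_lt : forall x y, x < hn h -> y \in hadj h x -> y < hn h }.

Section Plans.
Variables (h : host) (inp : seq nat) (W : nat).
Local Notation n := (hn h).
Local Notation adj := (hadj h).
Hypothesis enc : encodes h inp.
Hypothesis W_large : n.+2 ^ 3 <= W.

Local Notation spec := (spec W inp).

Lemma deg_leq x : x < n -> size (adj x) <= n.
Proof.
move=> xn; rewrite -[X in _ <= X](size_iota 0) uniq_leq_size ?(enc_uniq enc) //.
by move=> y /(enc_lt enc xn); rewrite mem_iota.
Qed.

Lemma W_ge : n.+2 ^ 2 + n.+2 <= W.
Proof. by apply: leq_trans W_large; rewrite !expnS expn0; nia. Qed.

Lemma inp_leq i : nth 0 inp i <= W.
Proof. by have := enc_small enc i; have := W_ge; lia. Qed.

(* [y] is the register of a vertex, [k] counts down its list and [z] receives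
   the neighbours. *)
Definition nloop y k z c :=
  Seq (Asg k (Bin OSub (Rd (Bin OAdd (Var y) (Cst 2))) (Rd (Bin OAdd (Var y) (Cst 1)))))
    (loop k (Seq (Asg z (Rd (Bin OSub
       (Bin OAdd (Rd (Bin OAdd (Var y) (Cst 1))) (Var k)) (Cst 1)))) c)).

Lemma spec_nloop y k z r c s (F T : nat -> nat) (I Q : (nat -> nat) -> Prop) t :
  s y < n -> y <> k -> k <> r -> k <> z -> z <> r -> I s ->
  (forall s1 v, I s1 -> I (upd s1 k v)) -> (forall s1 v, I s1 -> I (upd s1 z v)) ->
  (forall s1, I s1 -> s1 y = s y) ->
  (forall w s1, w \in adj (s y) -> I s1 -> s1 z = w ->
     s1 r + F w <= s r + \sum_(j <- adj (s y)) F j ->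
     spec c s1 (T w) (fun s2 => [/\ I s2, s2 k = s1 k & s2 r = s1 r + F w])) ->
  (forall s', I s' -> s' r = s r + \sum_(j <- adj (s y)) F j -> Q s') ->
  \sum_(j <- adj (s y)) (T j + 21) + 14 <= t ->
  spec (nloop y k z c) s t Q.
Proof.
move=> syn yk kr kz zr Is Ik Iz Iy body QI le_t.
have Wge := W_ge; have n4 : n.+1 <= n.+2 ^ 2 by rewrite expnS expn1; nia.
have sumE G : \sum_(j <- adj (s y)) G j = \sum_(j < size (adj (s y))) G (nth 0 (adj (s y)) j).
  by rewrite (big_nth 0) big_mkord.
have degn := deg_leq syn.
apply: (@spec_seq _ _ _ _ _ 13 (t - 13)); last by lia.
apply: spec_asg => //.
  by rewrite /= !inp_leq; apply/andP; split; [have := inp_leq (s y + 2); lia | lia].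
set s1 := upd _ _ _.
have s1k : s1 k = size (adj (s y)) by rewrite /s1 upd_eq /= (enc_deg enc) //; lia.
have Is1 : I s1 by apply: Ik.
have s1r : s1 r = s r by rewrite /s1; upds.
apply: (@spec_loop _ _ k r _ _ _ (fun i => F (nth 0 (adj (s y)) i))
  (fun i => T (nth 0 (adj (s y)) i) + 13) I) => //.
- by rewrite s1k; lia.
- rewrite s1k => i s2 i_lt Is2 s2k le2.
  set w := nth 0 _ i in le2 *.
  have wadj : w \in adj (s y) by apply: mem_nth.
  apply: (@spec_seq _ _ _ _ _ 13 (T w)); last by lia.
  apply: spec_asg => //.
    rewrite /= !inp_leq !Iy //= s2k; have := enc_small enc (s y + 1).
    by move=> *; lia.
  have -> : eval inp s2 (Rd (Bin OSub (Bin OAdd (Rd (Bin OAdd (Var y) (Cst 1))) (Var k)) (Cst 1))) = w.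
    by rewrite /= Iy // s2k addnS subn1 /= (enc_nbr enc).
  apply: spec_weak (body w _ wadj (Iz _ _ Is2) _ _) (leqnn _) _.
  + by rewrite upd_eq.
  + by upds; rewrite sumE -s1r.
  + by move=> s3 [Is3 s3k s3r]; split=> //; [rewrite s3k | rewrite s3r]; upds.
- by move=> s' Is' s'r; apply: QI => //; rewrite s'r s1r s1k sumE.
- rewrite s1k; have -> : \sum_(j < size (adj (s y))) (T (nth 0 (adj (s y)) j) + 13 + 8) =
    \sum_(j <- adj (s y)) (T j + 21).
    by rewrite sumE; apply: eq_bigr => j _; rewrite -addnA.
  by lia.
Qed.

(** Under truncated subtraction, 1 - ((z - y) + (y - z)) is 1 exactly when z = y. Its sum over a
    list without repetitions is the membership bit. *)
Definition adjacent x y r :=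
  Seq (Asg r (Cst 0)) (nloop x r.+1 r.+2
    (Asg r (Bin OAdd (Var r) (Bin OSub (Cst 1)
      (Bin OAdd (Bin OSub (Var r.+2) (Var y)) (Bin OSub (Var y) (Var r.+2))))))).

Lemma spec_adjacent x y r s : x < r -> y < r -> s x < n -> s y <= n ->
  spec (adjacent x y r) s (40 * (size (adj (s x))).+1)
    (fun s' => (forall a, a < r -> s' a = s a) /\ s' r = (s y \in adj (s x))).
Proof.
move=> xr yr sx sy; have Wge := W_ge; have n4 : n.+1 <= n.+2 ^ 2 by rewrite expnS expn1; nia.
apply: (@spec_seq _ _ _ _ _ 3 (39 * size (adj (s x)) + 14)); last by lia.
apply: spec_asg => //.
pose I (s' : nat -> nat) := forall a, a < r -> s' a = s a.
set s0 := upd _ _ _.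
have Is0 : I s0 by move=> a ar; rewrite /s0; upds.
have s0x : s0 x = s x by apply: Is0.
have cE : \sum_(j <- adj (s x)) (j == s y) = (s y \in adj (s x)).
  rewrite -count_uniq_mem ?(enc_uniq enc) // -sum1_count [RHS]big_mkcond /=.
  by apply: eq_bigr => j _; case: (j == s y).
apply: (@spec_nloop _ _ _ r _ _ (fun w => w == s y) (fun _ => 18) I); rewrite ?s0x //; try lia.
- by move=> s1 v Is1 a ar; upds; apply: Is1.
- by move=> s1 v Is1 a ar; upds; apply: Is1.
- by move=> s1 Is1; rewrite Is1.
- move=> w s1 wadj Is1 s1z le1.
  have wn := enc_lt enc sx wadj.
  have s1y : s1 y = s y by apply: Is1.
  have le1' : s1 r + (w == s y) <= 1.
    by apply: leq_trans le1 _; rewrite cE /s0 upd_eq /=; case: (_ \in _).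
  have eqE : 1 - (w - s y + (s y - w)) = (w == s y) by case: eqP => //; lia.
  apply: spec_asg; rewrite /= ?s1z ?s1y ?eqE //.
    by lia.
  split; upds => //.
  by move=> a ar; upds; apply: Is1.
- by move=> s' Is' s'r; split=> //; rewrite s'r cE /s0 upd_eq.
- by rewrite big_const_seq count_predT iter_addn_0; lia.
Qed.

Fixpoint all_adjacent x ys q :=
  match ys with
  | [::] => Asg q (Cst 1)
  | y :: ys => Seq (all_adjacent x ys q)
      (Seq (adjacent x y q.+1) (Asg q (Bin OMul (Var q) (Var q.+1))))
  end.

Lemma spec_all_adjacent x ys q s : x < q -> (forall y, y \in ys -> y < q /\ s y <= n) ->
  s x < n ->
  spec (all_adjacent x ys q) s (3 + 50 * size ys * (size (adj (s x))).+1)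
    (fun s' => (forall a, a < q -> s' a = s a) /\
      s' q = all (fun y => s y \in adj (s x)) ys).
Proof.
move=> xq + sx; have Wge := W_ge; elim: ys => [|y ys IH] ysP /=.
  by apply: spec_asg => //=; [lia | split=> [a aq|]; upds].
have [yq sy] : y < q /\ s y <= n by apply: ysP; rewrite mem_head.
apply: (@spec_seq _ _ _ _ _ _ (50 * (size (adj (s x))).+1)).
  apply: spec_weak (IH _) (leqnn _) _.
    by move=> y' y'ys; apply: ysP; rewrite inE y'ys orbT.
  move=> s1 [fr1 s1q].
  have s1x := fr1 x xq; have s1y := fr1 y yq.
  apply: (@spec_seq _ _ _ _ _ _ 7).
    apply: spec_weak (@spec_adjacent x y q.+1 s1 _ _ _ _) (leqnn _) _; try lia.
    move=> s2 [fr2 s2q].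
    have s2q0 := fr2 q (ltnSn q).
    apply: spec_asg => //=; rewrite ?s2q0 ?s2q ?s1q ?s1x ?s1y.
      by case: (all _ _); case: (_ \in _) => /=; lia.
    split=> [a aq|]; upds; first by rewrite fr2 ?fr1 //; lia.
    by rewrite mulnb andbC.
  by rewrite s1x; lia.
by move: (size ys) (size _) => b c; nia.
Qed.

(* A plan is a nest of loops: [PVert v N p] runs v through all host vertices,
   [PNbr u v N p] through the neighbours of the image of u; both keep the images
   adjacent to those of the list N. *)
Inductive plan :=
| PNil
| PSplit of plan & plan
| PVert of nat & seq nat & plan
| PNbr of nat & nat & seq nat & plan.

(** Membership is tested in the list of the new vertex [y]: over a loop through all vertices one
    such test scans every list once, O(n) in total for bounded degeneracy. *)
Definition compatible (a : nat -> nat) N y := all (fun j => a j \in adj y) N.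

Fixpoint pval p (a : nat -> nat) : nat :=
  match p with
  | PNil => 1
  | PSplit p q => pval p a * pval q a
  | PVert v N p => \sum_(y <- iota 0 n) compatible a N y * pval p (upd a v y)
  | PNbr u v N p => \sum_(y <- adj (a u)) compatible a N y * pval p (upd a v y)
  end.

Definition step_cost (N : seq nat) y := 100 + 50 * size N * (size (adj y)).+1.

Fixpoint cost p (a : nat -> nat) : nat :=
  match p with
  | PNil => 3
  | PSplit p q => cost p a + cost q a + 10
  | PVert v N p => \sum_(y <- iota 0 n) (step_cost N y + cost p (upd a v y)) + 20
  | PNbr u v N p => \sum_(y <- adj (a u)) (step_cost N y + cost p (upd a v y)) + 20
  end.

(** Exponent of the trivial bound on [pval]. It governs the word size; the time exponent comes from
    [eliminable]. *)
Fixpoint binders p :=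
  match p with
  | PNil => 0
  | PSplit p q => binders p + binders q
  | PVert _ _ p | PNbr _ _ _ p => (binders p).+1
  end.

Fixpoint scoped D p :=
  match p with
  | PNil => true
  | PSplit p q => scoped D p && scoped D q
  | PVert v _ p => scoped (v :: D) p
  | PNbr u v _ p => (u \in D) && scoped (v :: D) p
  end.

Definition in_range (D : seq nat) (a : nat -> nat) := forall j, j \in D -> a j < n.

Lemma in_range_cons D a v y : in_range D a -> y < n -> in_range (v :: D) (upd a v y).
Proof.
move=> Da yn j; rewrite inE /upd; case: eqP => //= _; exact: Da.
Qed.

Arguments in_range_cons [D a] v [y].

Lemma sum_leq_const (s : seq nat) F m : size s <= n ->
  (forall y, y \in s -> F y <= m) -> \sum_(y <- s) F y <= n.+1 * m.
Proof.
move=> sn Fm; rewrite big_seq; apply: (@leq_trans (\sum_(y <- s | y \in s) m)).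
  by apply: leq_sum.
by rewrite -big_seq big_const_seq count_predT iter_addn_0 mulnC leq_mul2r (leqW sn) orbT.
Qed.

Lemma pval_leq p D a : scoped D p -> in_range D a -> pval p a <= n.+1 ^ binders p.
Proof.
elim: p D a => [|p IHp q IHq|v N p IH|u v N p IH] D a //=.
- by move=> /andP [sp sq] Da; rewrite expnD leq_mul ?(IHp D) ?(IHq D).
- move=> sp Da; rewrite expnS; apply: sum_leq_const => [|y]; first by rewrite size_iota.
  rewrite mem_iota => yn; apply: leq_trans (IH _ _ sp (in_range_cons v Da yn)).
  by case: compatible; rewrite ?mul1n.
- move=> /andP [uD sp] Da; have au := Da u uD.
  rewrite expnS; apply: sum_leq_const => [|y]; first exact: deg_leq.
  move=> /(enc_lt enc au) yn; apply: leq_trans (IH _ _ sp (in_range_cons v Da yn)).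
  by case: compatible; rewrite ?mul1n.
Qed.


(* Register [r.+2] holds the new vertex, [r] accumulates the count. *)
Definition pbody regs r c :=
  Seq (all_adjacent r.+2 regs r.+3)
   (Seq c (Asg r (Bin OAdd (Var r) (Bin OMul (Var r.+3) (Var r.+4))))).

(** [env] sends a vertex of H to the register of its image. The value is left in [r], registers from
    [r] on are free, and register 1 holds the number of host vertices throughout. *)
Fixpoint pcode p (env : nat -> nat) r :=
  match p with
  | PNil => Asg r (Cst 1)
  | PSplit p q => Seq (pcode p env r)
      (Seq (pcode q env r.+1) (Asg r (Bin OMul (Var r) (Var r.+1))))
  | PVert v N p => Seq (Asg r (Cst 0)) (Seq (Asg r.+1 (Var 1))
      (loop r.+1 (Seq (Asg r.+2 (Bin OSub (Var r.+1) (Cst 1)))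
        (pbody (map env N) r (pcode p (upd env v r.+2) r.+4)))))
  | PNbr u v N p => Seq (Asg r (Cst 0)) (nloop (env u) r.+1 r.+2
      (pbody (map env N) r (pcode p (upd env v r.+2) r.+4)))
  end.

Definition computes c r s t x :=
  spec c s t (fun s' => (forall a, a < r -> s' a = s a) /\ s' r = x).

Lemma spec_pbody v N p env r s a y m : 1 < r -> (forall j, env j < r) ->
  (forall j, s (env j) = a j) -> (forall j, a j <= n) -> s r.+2 = y -> y < n ->
  s r + compatible a N y * pval p (upd a v y) <= m ->
  pval p (upd a v y) <= m -> m <= W ->
  (forall s1, (forall i, i < r.+3 -> s1 i = s i) ->
     (forall j, upd env v r.+2 j < r.+4) ->
     (forall j, s1 (upd env v r.+2 j) = upd a v y j) ->
     computes (pcode p (upd env v r.+2) r.+4) r.+4 s1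
       (cost p (upd a v y)) (pval p (upd a v y))) ->
  spec (pbody (map env N) r (pcode p (upd env v r.+2) r.+4)) s
    (13 + 50 * size N * (size (adj y)).+1 + cost p (upd a v y))
    (fun s' => [/\ forall i, i < r -> s' i = s i, s' r.+1 = s r.+1 &
      s' r = s r + compatible a N y * pval p (upd a v y)]).
Proof.
move=> r1 envP sa an sy yn; set a' := upd a v y => lem lem' mW IH.
have Wge := W_ge; have n4 : n.+1 <= n.+2 ^ 2 by rewrite expnS expn1; nia.
apply: (@spec_seq _ _ _ _ _ (3 + 50 * size (map env N) * (size (adj (s r.+2))).+1)
  (10 + cost p a')); last by rewrite size_map sy; lia.
apply: spec_weak (@spec_all_adjacent r.+2 (map env N) r.+3 s _ _ _) (leqnn _) _.
- by lia.
- by move=> _ /mapP [j _ ->]; have := envP j; rewrite sa; split=> //; lia.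
- by rewrite sy.
move=> s1 [fr1 s1q].
have fr1' j : s1 (env j) = a j by rewrite -sa; apply: fr1; have := envP j; lia.
apply: (@spec_seq _ _ _ _ _ (cost p a') 10); last by lia.
apply: spec_weak (IH s1 fr1 _ _) (leqnn _) _.
- by move=> j; rewrite /upd; have := envP j; case: (j == v); lia.
- by move=> j; rewrite /a' /upd; case: (j == v); rewrite ?fr1' // fr1 ?sy.
move=> s2 [fr2 s2r].
have s2q : s2 r.+3 = compatible a N y.
  rewrite fr2 // s1q all_map sy; congr (nat_of_bool _).
  by apply: eq_all => j /=; rewrite sa.
have s2a : s2 r = s r by rewrite fr2 ?fr1; lia.
apply: spec_asg => //=.
  rewrite s2q s2a s2r; move: lem lem'; case: compatible; rewrite ?mul1n ?mul0n ?addn0; lia.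
split.
- by move=> i ir; upds; rewrite fr2 ?fr1; lia.
- by upds; rewrite fr2 ?fr1; lia.
- by upds; rewrite s2q s2a s2r.
Qed.

Lemma computes_pcode p env r s D a : 1 < r -> (forall j, env j < r) ->
  (forall j, s (env j) = a j) -> (forall j, a j <= n) -> s 1 = n ->
  scoped D p -> in_range D a -> n.+2 ^ (binders p + 3) <= W ->
  computes (pcode p env r) r s (cost p a) (pval p a).
Proof.
have Wge := W_ge; have n4 : n.+1 <= n.+2 ^ 2 by rewrite expnS expn1; nia.
have powS b : n.+1 ^ b <= n.+2 ^ (b + 3).
  apply: (@leq_trans (n.+2 ^ b)); last by rewrite leq_exp2l // leq_addr.
  by case: b => // b; rewrite leq_exp2r.
have updn b v y : (forall j, b j <= n) -> y < n -> forall j, upd b v y j <= n.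
  by move=> bn yn j; rewrite /upd; case: eqP => // _; apply: ltnW.
have sum_part (l : seq nat) (G : nat -> nat) y : y \in l -> G y <= \sum_(z <- l) G z.
  by move=> yl; rewrite (big_rem y) //= leq_addr.
elim: p env r s D a => [|p IHp q IHq|v N p IH|u v N p IH] env r s D a r1 envP sa an s1n /=.
- move=> _ _ _; apply: spec_asg => //=; first by lia.
  by split=> [i ir|]; upds.
- move=> /andP [sp sq] Da leW.
  have leWp : n.+2 ^ (binders p + 3) <= W.
    by apply: leq_trans leW; rewrite leq_exp2l //; lia.
  have leWq : n.+2 ^ (binders q + 3) <= W.
    by apply: leq_trans leW; rewrite leq_exp2l //; lia.
  apply: (@spec_seq _ _ _ _ _ (cost p a) (cost q a + 10)); last by lia.
  apply: spec_weak (IHp env r s D a r1 envP sa an s1n sp Da leWp) (leqnn _) _.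
  move=> s1 [fr1 s1r]; apply: (@spec_seq _ _ _ _ _ (cost q a) 10); last by lia.
  apply: spec_weak (IHq env r.+1 s1 D a _ _ _ an _ sq Da leWq) (leqnn _) _.
  + by lia.
  + by move=> j; have := envP j; lia.
  + by move=> j; rewrite fr1.
  + by rewrite fr1.
  move=> s2 [fr2 s2r]; have s2r' : s2 r = s1 r by apply: fr2.
  have vW : pval p a * pval q a <= W.
    apply: leq_trans leW; apply: leq_trans (powS _); rewrite expnD.
    by rewrite leq_mul // (@pval_leq _ D).
  apply: spec_asg => //=.
    rewrite s2r' s1r s2r vW !andbT /=; apply/andP; split.
      by apply: leq_trans (pval_leq sp Da) (leq_trans (powS _) leWp).
    by apply: leq_trans (pval_leq sq Da) (leq_trans (powS _) leWq).
  by split=> [i ir|]; upds; [rewrite fr2 ?fr1 //; lia | rewrite s2r' s1r s2r].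
- move=> sp Da leW.
  have leWp : n.+2 ^ (binders p + 3) <= W.
    by apply: leq_trans leW; rewrite leq_exp2l //; lia.
  have valW : \sum_(y <- iota 0 n) compatible a N y * pval p (upd a v y) <= W.
    by apply: leq_trans (@pval_leq (PVert v N p) D _ sp Da) (leq_trans (powS _) leW).
  have valpW y : y < n -> pval p (upd a v y) <= W.
    move=> yn; apply: leq_trans (pval_leq sp (in_range_cons v Da yn)) _.
    exact: leq_trans (powS _) leWp.
  have sumE (G : nat -> nat) : \sum_(y <- iota 0 n) G y = \sum_(j < n) G j.
    by rewrite -(big_mkord predT) /index_iota subn0.
  apply: (@spec_seq _ _ _ _ _ 3 (\sum_(y <- iota 0 n) (step_cost N y + cost p (upd a v y)) + 17)); last by lia.
  apply: spec_asg => //; apply: (@spec_seq _ _ _ _ _ 4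
    (\sum_(y <- iota 0 n) (step_cost N y + cost p (upd a v y)) + 13)); last by lia.
  apply: spec_asg => //; first by rewrite /=; upds; lia.
  set s0 := upd (upd s r _) r.+1 _.
  have fr0 i : i < r -> s0 i = s i by move=> ir; rewrite /s0; upds.
  have s0r : s0 r = 0 by rewrite /s0; upds.
  pose I (s' : nat -> nat) := forall i, i < r -> s' i = s i.
  apply: (@spec_loop _ _ r.+1 r _ _ n (fun y => compatible a N y * pval p (upd a v y))
    (fun y => 19 + 50 * size N * (size (adj y)).+1 + cost p (upd a v y)) I) => //.
  + by rewrite /s0; upds; rewrite /= upd_ne //; lia.
  + by lia.
  + by lia.
  + by move=> s2 w Is2 i ir; upds; apply: Is2.
  + rewrite s0r add0n => y s2 yn Is2 s2k le2.
    have valW' : \sum_(j < n) compatible a N j * pval p (upd a v j) <= W.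
      by move: valW; rewrite sumE.
    apply: (@spec_seq _ _ _ _ _ 6 (13 + 50 * size N * (size (adj y)).+1 + cost p (upd a v y))); last by lia.
    apply: spec_asg => //; first by rewrite /= s2k; lia.
    set s3 := upd s2 r.+2 _.
    have fr3 i : i < r -> s3 i = s i by move=> ir; rewrite /s3; upds; apply: Is2.
    have s3r : s3 r = s2 r by rewrite /s3; upds.
    apply: spec_weak (@spec_pbody v N p env r s3 a y W _ _ _ _ _ _ _ _ _ _) (leqnn _) _ => //.
    * by move=> j; rewrite fr3.
    * by rewrite /s3; upds; rewrite /= s2k subn1.
    * by rewrite s3r; apply: leq_trans le2 valW'.
    * exact: valpW.
    * move=> s4 fr4 env4 a4; apply: IH (in_range_cons v Da yn) leWp => //.
      - exact: updn.
      - by rewrite fr4 ?fr3; lia.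
    * move=> s4 [fr4 s4k s4r]; split.
      - by move=> i ir; rewrite fr4 ?fr3.
      - by rewrite s4k /s3; upds.
      - by rewrite s4r s3r.
  + by move=> s' Is' s'r; split=> //; rewrite s'r s0r sumE.
  + rewrite sumE; apply: (@leq_trans (\sum_(j < n) (step_cost N j + cost p (upd a v j)) + 1)); last by lia.
    by rewrite leq_add2r; apply: leq_sum => j _; rewrite /step_cost; lia.
- move=> /andP [uD sp] Da leW.
  have au : a u < n by apply: Da.
  have su : s (env u) = a u by apply: sa.
  have eu := envP u.
  have leWp : n.+2 ^ (binders p + 3) <= W.
    by apply: leq_trans leW; rewrite leq_exp2l //; lia.
  have valW : \sum_(y <- adj (a u)) compatible a N y * pval p (upd a v y) <= W.
    apply: leq_trans (@pval_leq (PNbr u v N p) D _ _ Da) (leq_trans (powS _) leW).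
    by rewrite /= uD.
  have valpW y : y < n -> pval p (upd a v y) <= W.
    move=> yn; apply: leq_trans (pval_leq sp (in_range_cons v Da yn)) _.
    exact: leq_trans (powS _) leWp.
  apply: (@spec_seq _ _ _ _ _ 3 (\sum_(y <- adj (a u)) (step_cost N y + cost p (upd a v y)) + 17)); last by lia.
  apply: spec_asg => //.
  set s0 := upd s r _.
  have fr0 i : i < r -> s0 i = s i by move=> ir; rewrite /s0; upds.
  have s0r : s0 r = 0 by rewrite /s0; upds.
  have s0u : s0 (env u) = a u by rewrite fr0.
  pose I (s' : nat -> nat) := forall i, i < r -> s' i = s i.
  apply: (@spec_nloop _ r.+1 r.+2 r _ _ (fun y => compatible a N y * pval p (upd a v y))
    (fun y => 13 + 50 * size N * (size (adj y)).+1 + cost p (upd a v y)) I);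
    rewrite ?s0u ?s0r //; try lia.
  + by move=> s2 w Is2 i ir; upds; apply: Is2.
  + by move=> s2 w Is2 i ir; upds; apply: Is2.
  + by move=> s2 Is2; rewrite Is2.
  + rewrite add0n => y s2 yadj Is2 s2z le2; have yn := enc_lt enc au yadj.
    apply: spec_weak (@spec_pbody v N p env r s2 a y W _ _ _ _ _ _ _ _ _ _) (leqnn _) _ => //.
    * by move=> j; rewrite Is2.
    * exact: leq_trans le2 valW.
    * exact: valpW.
    * move=> s4 fr4 env4 a4; apply: IH (in_range_cons v Da yn) leWp => //.
      - exact: updn.
      - by rewrite fr4 ?Is2; lia.
    * move=> s4 [fr4 s4k s4r]; split=> //.
      by move=> i ir; rewrite fr4 ?Is2.
  + apply: leq_add => //; apply: leq_sum => j _.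
    by rewrite /step_cost; lia.
Qed.

End Plans.
Arguments in_range_cons [h D a] v [y].

(** * From elimination orders to plans *)

Section Extensions.
Variables (k n : nat) (e : rel 'I_k) (eG : rel 'I_n).
Hypotheses (e_sym : symmetric e) (e_irr : irreflexive e) (eG_sym : symmetric eG).
Implicit Types (A B C : {set 'I_k}) (D : seq 'I_k) (g f : {ffun 'I_k -> 'I_n}).

(** Extensions to [C] of a map placed on [D], as total functions frozen to [f] outside [C]. Edges
    inside [D] are not imposed, having been tested when [D] was placed. *)
Definition ext C D f : {set {ffun 'I_k -> 'I_n}} :=
  [set g : {ffun 'I_k -> 'I_n} | [forall i, (i \notin C) ==> (g i == f i)] &&
    [forall i in C, forall j, ((j \in C) || (j \in D)) && e i j ==> eG (g i) (g j)]].

Lemma extP C D f g : reflect ((forall i, i \notin C -> g i = f i) /\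
    (forall i j, i \in C -> (j \in C) || (j \in D) -> e i j -> eG (g i) (g j)))
  (g \in ext C D f).
Proof.
rewrite inE; apply: (iffP andP) => [[/forallP gf /forall_inP gE]|[gf gE]]; split.
- by move=> i iC; apply/eqP; have /implyP := gf i; apply.
- by move=> i j iC jCD eij; have /forallP/(_ j)/implyP := gE i iC; apply; rewrite jCD.
- by apply/forallP => i; apply/implyP => iC; apply/eqP/gf.
- apply/forall_inP => i iC; apply/forallP => j; apply/implyP => /andP [jCD eij].
  exact: gE.
Qed.

Lemma card_ext0 D f : #|ext set0 D f| = 1.
Proof.
rewrite -(cards1 f); apply: eq_card => g; rewrite in_set1; apply/extP/eqP => [[gf _]|->].
  by apply/ffunP => i; apply: gf; rewrite inE.
by split=> // i j; rewrite inE.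
Qed.

(** With no edge between [A] and [B], any two extensions can be glued. *)
Lemma card_extU A B D f : [disjoint A & B] ->
  (forall x y, x \in A -> y \in B -> ~~ e x y) ->
  (forall j, j \in D -> j \notin A :|: B) ->
  #|ext (A :|: B) D f| = #|ext A D f| * #|ext B D f|.
Proof.
move=> dAB nAB dD; rewrite -cardsX.
pose glue (p : {ffun 'I_k -> 'I_n} * {ffun 'I_k -> 'I_n}) : {ffun 'I_k -> 'I_n} :=
  [ffun i => if i \in A then p.1 i else p.2 i].
have nB i : i \in A -> i \notin B by move=> iA; rewrite (disjointFr dAB).
have nA i : i \in B -> i \notin A by move=> iB; rewrite (disjointFl dAB).
have dDA j : j \in D -> j \notin A by move/dD; rewrite inE negb_or => /andP [].
have dDB j : j \in D -> j \notin B by move/dD; rewrite inE negb_or => /andP [].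
rewrite -(card_in_imset (f := glue)); last first.
  move=> [g1 g2] [h1 h2] /setXP /= [/extP [g1f _] /extP [g2f _]].
  move=> /setXP /= [/extP [h1f _] /extP [h2f _]] /ffunP eq_gh.
  congr pair; apply/ffunP => i.
    case: (boolP (i \in A)) => iA; last by rewrite g1f ?h1f.
    by have := eq_gh i; rewrite !ffunE iA.
  case: (boolP (i \in B)) => iB; last by rewrite g2f ?h2f.
  by have := eq_gh i; rewrite !ffunE (negPf (nA i iB)).
apply: eq_card => g; apply/extP/imsetP => [[gf gE]|[[g1 g2] /setXP /= [/extP [g1f g1E] /extP [g2f g2E]] ->]].
  exists ([ffun i => if i \in A then g i else f i], [ffun i => if i \in B then g i else f i]).
    apply/setXP; split; apply/extP; split=> [i iA|i j iA jAD eij]; rewrite !ffunE ?(negPf iA) //= iA.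
      have := gE i j; rewrite !inE iA.
      case/orP: jAD => [jA|jD]; first by rewrite jA; apply.
      by rewrite (negPf (dDA j jD)) jD orbT (gf j (dD j jD)); apply.
    have := gE i j; rewrite !inE iA orbT.
    case/orP: jAD => [jB|jD]; first by rewrite jB orbT; apply.
    by rewrite (negPf (dDB j jD)) jD orbT (gf j (dD j jD)); apply.
  apply/ffunP => i; rewrite !ffunE /=; case: (boolP (i \in A)) => iA //.
  case: (boolP (i \in B)) => iB //.
  by rewrite gf // inE negb_or iA.
split=> [i|i j].
  by rewrite inE negb_or !ffunE => /andP [iA iB]; rewrite (negPf iA) g2f.
rewrite !inE !ffunE /= => /orP [iA|iB] jABD eij.
  have jB : j \notin B by apply/negP=> jB; have := nAB i j iA jB; rewrite eij.
  move: jABD; rewrite iA (negPf jB) orbF => jAD.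
  have := g1E i j iA jAD eij; case: (boolP (j \in A)) => // jA.
  by rewrite (g1f j jA) (g2f j jB).
have jA : j \notin A by apply/negP=> jA; have := nAB j i jA iB; rewrite e_sym eij.
by move: jABD; rewrite (negPf (nA i iB)) (negPf jA) /= => jBD; apply: g2E.
Qed.

Definition updf f v x : {ffun 'I_k -> 'I_n} := [ffun i => if i == v then x else f i].

(** Sort the extensions by the image [x] of [v]. Edges from [v] to [D] become the tests; those to
    the rest of [C] are imposed later, [v] having joined [D]. *)
Lemma card_ext1 C D f v : v \in C -> (forall j, j \in D -> j \notin C) ->
  #|ext C D f| = \sum_(x : 'I_n) all (fun j => eG x (f j)) [seq j <- D | e v j] *
    #|ext (C :\ v) (v :: D) (updf f v x)|.
Proof.
move=> Cv dD; rewrite -sum1_card (partition_big (fun g => g v) predT) //=.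
apply: eq_bigr => x _; rewrite sum1dep_card.
case: allP => [xD|nxD]; rewrite ?mul1n ?mul0n.
  apply: eq_card => g; rewrite in_set; apply/andP/idP.
    case=> /extP [gf gE] /eqP gv; apply/extP; split=> [i|i j].
      rewrite !inE negb_and negbK ffunE; case: eqP => [->|_ iC] //; exact: gf.
    rewrite !inE => /andP [iv iC] jCD; apply: gE => //.
    by move: jCD; case: eqP => [->|_] //=; rewrite Cv.
  case/extP=> gf gE.
  have gv : g v = x by rewrite gf ?ffunE ?eqxx // !inE eqxx.
  split; last exact/eqP.
  apply/extP; split=> [i iC|i j iC jCD eij].
    have niv : i != v by apply: contraNneq iC => ->.
    by rewrite gf ?ffunE ?(negPf niv) // !inE niv.
  case: (eqVneq i v) => [iv|niv]; last first.
    by apply: gE => //; rewrite !inE ?niv //; move: jCD; case: (j == v); rewrite ?orbT.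
  case: (boolP (j \in C)) jCD => /= [jC _|jC jD].
    have njv : j != v by apply: contraTneq eij => ->; rewrite iv e_irr.
    by rewrite eG_sym; apply: gE; rewrite ?(e_sym j) // !inE ?njv // iv eqxx orbT.
  have njv : j != v by apply: contraNneq jC => ->.
  rewrite iv gv gf ?ffunE ?(negPf njv) ?inE ?negb_and ?jC ?orbT //.
  by apply: xD; rewrite mem_filter -iv eij.
apply/eqP; rewrite cards_eq0; apply/eqP/setP => g; rewrite !inE.
apply/negP=> /andP [gin /eqP gv]; case: nxD => j; rewrite mem_filter => /andP [evj jD].
have /extP [gf gE] : g \in ext C D f by rewrite inE.
by rewrite -gv -gf ?dD //; apply: gE; rewrite ?jD ?orbT.
Qed.

End Extensions.

Record represents (dd n : nat) (adj : nat -> seq nat) (eG : rel 'I_n) : Prop := Represents {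
  rep_uniq : forall x, x < n -> uniq (adj x);
  rep_lt : forall x y, x < n -> y \in adj x -> y < n;
  rep_mem : forall u v : 'I_n, (val u \in adj (val v)) = eG v u;
  rep_sum : \sum_(x < n) size (adj x) <= dd * n }.

Lemma sum_iota n F : \sum_(y <- iota 0 n) F y = \sum_(x < n) F (val x).
Proof. by rewrite -(big_mkord predT) /index_iota subn0. Qed.

Lemma sum_adj dd n adj (eG : rel 'I_n) (x : 'I_n) F : represents dd adj eG ->
  \sum_(y <- adj x) F y = \sum_(y < n) eG x y * F (val y).
Proof.
move=> rep; have ux := rep_uniq rep (ltn_ord x).
have -> : \sum_(y <- adj x) F y = \sum_(y <- [seq y <- iota 0 n | y \in adj x]) F y.
  apply: perm_big; apply: uniq_perm => //; first by rewrite filter_uniq ?iota_uniq.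
  move=> y; rewrite mem_filter mem_iota /= add0n; case: (boolP (y \in adj x)) => // yx.
  by rewrite (rep_lt rep (ltn_ord x) yx).
rewrite big_filter big_mkcond sum_iota; apply: eq_bigr => y _.
by rewrite (rep_mem rep); case: (eG x y); rewrite ?mul1n.
Qed.

Definition nats k (D : seq 'I_k) := [seq val j | j <- D].

Lemma mem_nats k (D : seq 'I_k) (j : 'I_k) : (val j \in nats D) = (j \in D).
Proof. by rewrite mem_map //; apply: val_inj. Qed.

Section Realize.
Variables (k dd : nat) (e : rel 'I_k).
Hypotheses (e_sym : symmetric e) (e_irr : irreflexive e).
Implicit Types (A B C : {set 'I_k}) (D : seq 'I_k) (p q : plan).

(** For [n = 0] there may be no [f] to extend, hence the separate clause: the only map is the empty
    one. *)
Definition realizes (p : plan) (C : {set 'I_k}) (D : seq 'I_k) :=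
  forall n adj (eG : rel 'I_n) a, symmetric eG -> represents dd adj eG ->
    in_range (Host n adj) (nats D) a ->
    (n = 0 -> pval (Host n adj) p a = (C == set0)) /\
    forall f : {ffun 'I_k -> 'I_n}, (forall j, j \in D -> a (val j) = val (f j)) ->
      pval (Host n adj) p a = #|ext e eG C D f|.

Definition runs_in (p : plan) (D : seq 'I_k) c t :=
  forall n adj (eG : rel 'I_n) a, represents dd adj eG ->
    in_range (Host n adj) (nats D) a -> cost (Host n adj) p a <= c * n.+1 ^ t.

Definition nbrs v D := nats [seq j <- D | e v j].

Lemma compatibleE n adj (eG : rel 'I_n) D v a (f : {ffun 'I_k -> 'I_n}) (x : 'I_n) :
  represents dd adj eG -> (forall j, j \in D -> a (val j) = val (f j)) ->
  compatible (Host n adj) a (nbrs v D) x = all (fun j => eG x (f j)) [seq j <- D | e v j].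
Proof.
move=> rep af; rewrite /compatible /nbrs all_map; apply: eq_in_all => j.
by rewrite mem_filter => /andP [_ jD] /=; rewrite af // (rep_mem rep).
Qed.

Lemma upd_updf n (a : nat -> nat) (f : {ffun 'I_k -> 'I_n}) D v (x : 'I_n) :
  (forall j, j \in D -> a (val j) = val (f j)) ->
  forall j, j \in v :: D -> upd a (val v) x (val j) = val (updf f v x j).
Proof.
move=> af j; rewrite inE /upd ffunE (inj_eq val_inj).
by case: (j == v) => //=; apply: af.
Qed.

Lemma realizes_vert p C D v : v \in C -> (forall j, j \in D -> j \notin C) ->
  realizes p (C :\ v) (v :: D) -> realizes (PVert v (nbrs v D) p) C D.
Proof.
move=> Cv dD rp n adj eG a eG_sym rep Da; split=> [n0|f af] /=.
  rewrite sum_iota; move: eG eG_sym rep; rewrite n0 => *; rewrite big_ord0.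
  by case: eqP => // C0; rewrite C0 inE in Cv.
rewrite sum_iota (card_ext1 e_sym e_irr eG_sym _ Cv dD); apply: eq_bigr => x _.
rewrite (compatibleE _ _ rep af).
have [_ rpx] := rp n adj eG _ eG_sym rep (in_range_cons (val v) Da (ltn_ord x)).
by rewrite (rpx (updf f v x)) //; apply: upd_updf.
Qed.

Lemma realizes_nbr p C D u v : v \in C -> (forall j, j \in D -> j \notin C) ->
  u \in D -> e u v ->
  realizes p (C :\ v) (v :: D) -> realizes (PNbr u v (nbrs v D) p) C D.
Proof.
move=> Cv dD uD euv rp n adj eG a eG_sym rep Da; split=> [n0|f af] /=.
  by have := Da (val u); rewrite mem_nats uD => /(_ isT) /=; rewrite n0.
rewrite af // (sum_adj _ _ rep) (card_ext1 e_sym e_irr eG_sym _ Cv dD).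
apply: eq_bigr => x _; rewrite (compatibleE _ _ rep af).
have [_ rpx] := rp n adj eG _ eG_sym rep (in_range_cons (val v) Da (ltn_ord x)).
rewrite (rpx (updf f v x)); last exact: upd_updf.
(* [u] is among the tested vertices, so the restriction to neighbours of its image is absorbed by
   the tests. *)
rewrite mulnA mulnb; congr (nat_of_bool _ * _).
rewrite andb_idl // => /allP allx; rewrite eG_sym; apply: allx.
by rewrite mem_filter e_sym euv.
Qed.

Lemma realizes_split p q A B D : [disjoint A & B] ->
  (forall x y, x \in A -> y \in B -> ~~ e x y) ->
  (forall j, j \in D -> j \notin A :|: B) ->
  realizes p A D -> realizes q B D -> realizes (PSplit p q) (A :|: B) D.
Proof.
move=> dAB nAB dD rp rq n adj eG a eG_sym rep Da.
have [vp0 vp] := rp n adj eG a eG_sym rep Da.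
have [vq0 vq] := rq n adj eG a eG_sym rep Da.
split=> [n0|f af] /=; first by rewrite vp0 ?vq0 // mulnb setU_eq0.
by rewrite (vp f) ?(vq f) // card_extU.
Qed.

Lemma runs_in_vert p D v c t : runs_in p (v :: D) c t ->
  runs_in (PVert v (nbrs v D) p) D (120 + 50 * size D * dd.+1 + c) t.+1.
Proof.
move=> rp n adj eG a rep Da /=; rewrite sum_iota.
have szN : size (nbrs v D) <= size D by rewrite !size_map size_filter count_size.
set N := size (nbrs v D) in szN *; set M := size D in szN *.
have pow1 : 0 < n.+1 ^ t by rewrite expn_gt0.
have le1 : \sum_(x < n) (step_cost (Host n adj) (nbrs v D) x + cost (Host n adj) p (upd a (val v) x)) <=
   \sum_(x < n) (100 + 50 * M + 50 * M * size (adj x) + c * n.+1 ^ t).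
  apply: leq_sum => x _; apply: leq_add; last exact: rp rep (in_range_cons (val v) Da (ltn_ord x)).
  by rewrite /step_cost /= -/N; move: (size (adj x)) => b; nia.
apply: leq_trans (leq_add le1 (leqnn 20)) _.
rewrite !big_split /= -big_distrr /= !sum_nat_const card_ord.
have := rep_sum rep; move: (\sum_(x < n) _) => b; rewrite expnS.
move: (n.+1 ^ t) pow1 => q q1 le_b.
have leM : 50 * M * b <= 50 * M * (dd * n) by rewrite leq_mul2l le_b orbT.
have h1 : 50 * M * dd.+1 * n <= 50 * M * dd.+1 * (n.+1 * q).
  by rewrite leq_mul2l; apply/orP; right; nia.
have h2 : c * (n * q) <= c * (n.+1 * q) by rewrite leq_mul2l leq_mul2r leqnSn !orbT.
have h3 : 1 * n.+1 <= q * n.+1 by rewrite leq_mul2r q1 orbT.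
by nia.
Qed.

(** Over the whole outer loop the inner rounds number at most [dd * n]. Each round is granted a
    multiple of [n.+1 ^ t.+1], enough for the body and for the tests of [w]. *)
Lemma runs_in_edge p D v w c t : runs_in p (w :: v :: D) c t.+1 ->
  runs_in (PVert v (nbrs v D) (PNbr v w (nbrs w (v :: D)) p)) D
    (140 + 50 * size D * dd.+1 + dd * (100 + 50 * (size D).+1 + c)) t.+2.
Proof.
move=> rp n adj eG a rep Da /=; rewrite sum_iota.
have szN u E : size (nbrs u E) <= size E by rewrite !size_map size_filter count_size.
set M := size D; set q := n.+1 ^ t.
have degn x : x < n -> size (adj x) <= n.
  move=> xn; rewrite -[X in _ <= X](size_iota 0) uniq_leq_size ?(rep_uniq rep) //.
  by move=> y /(rep_lt rep xn); rewrite mem_iota.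
have q1 : 0 < q by rewrite expn_gt0.
pose B := 100 + 50 * M.+1 + c.
have inner (x : nat) : x < n -> \sum_(y <- adj (upd a (val v) x (val v)))
    (step_cost (Host n adj) (nbrs w (v :: D)) y +
     cost (Host n adj) p (upd (upd a (val v) x) (val w) y)) <= size (adj x) * (B * (n.+1 * q)).
  move=> xn; rewrite upd_eq big_seq.
  apply: (@leq_trans (\sum_(y <- adj x | y \in adj x) B * (n.+1 * q))); last first.
    by rewrite -big_seq big_const_seq count_predT iter_addn_0 mulnC.
  apply: leq_sum => y yx; have yn := rep_lt rep xn yx.
  have le_c : cost (Host n adj) p (upd (upd a v x) w y) <= c * (n.+1 * q).
    by rewrite /q -expnS; apply: rp rep (in_range_cons (val w) (in_range_cons (val v) Da xn) yn).
  have := degn y yn; have := szN w (v :: D).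
  rewrite /step_cost /= -/M; move: (size (nbrs _ _)) (size (adj y)) => b d lb ld.
  have : b * d.+1 <= M.+1 * n.+1 by rewrite leq_mul.
  have : n.+1 * 1 <= n.+1 * q by rewrite leq_mul2l q1 orbT.
  have : M.+1 * n.+1 <= M.+1 * (n.+1 * q) by rewrite leq_mul2l -[X in X <= _]muln1 leq_mul2l q1 !orbT.
  rewrite /B; move: le_c; rewrite muln1; move: (n.+1 * q) => z le_c h1 h2 h3.
  rewrite -mulnA; move: (b * d.+1) h3 => bd h3.
  rewrite !mulnDl -(mulnA 50); lia.
have le1 : \sum_(x < n) (step_cost (Host n adj) (nbrs v D) x +
    (\sum_(y <- adj (upd a (val v) x (val v)))
    (step_cost (Host n adj) (nbrs w (v :: D)) y +
     cost (Host n adj) p (upd (upd a (val v) x) (val w) y)) + 20)) <=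
   \sum_(x < n) (120 + 50 * M + size (adj x) * (50 * M + B * (n.+1 * q))).
  apply: leq_sum => x _; have := inner x (ltn_ord x).
  set i1 := \sum_(y <- _) _.
  rewrite mulnDr /step_cost /=; have := szN v D; rewrite -/M.
  move: (size (nbrs v D)) (size (adj x)) => b d lb.
  have : b * d.+1 <= M * d.+1 by rewrite leq_mul.
  by nia.
apply: leq_trans (leq_add le1 (leqnn 20)) _.
rewrite big_split /= -big_distrl /= !sum_nat_const card_ord.
have := rep_sum rep; move: (\sum_(x < n) _) => b le_b; rewrite !expnS -/q -/M -/B.
have h1 : b * (50 * M + B * (n.+1 * q)) <= (dd * n) * (50 * M + B * (n.+1 * q)) by rewrite leq_mul.
set z := n.+1 * q in h1 *.
have z1 : n.+1 <= z by rewrite /z -[X in X <= _]muln1 leq_mul2l q1 orbT.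
have zz : n.+1 <= n.+1 * z by rewrite -[X in X <= _]muln1 leq_mul2l; lia.
have h2 : (dd * B) * (n * z) <= (dd * B) * (n.+1 * z) by rewrite leq_mul2l leq_mul2r leqnSn !orbT.
have h3 : (50 * M * dd.+1) * n <= (50 * M * dd.+1) * (n.+1 * z) by rewrite leq_mul2l; apply/orP; right; lia.
by nia.
Qed.

Lemma runs_in_split p q D c c' t : runs_in p D c t -> runs_in q D c' t ->
  runs_in (PSplit p q) D (c + c' + 10) t.
Proof.
move=> rp rq n adj eG a rep Da /=.
have := rp n adj eG a rep Da; have := rq n adj eG a rep Da.
have : 0 < n.+1 ^ t by rewrite expn_gt0.
by nia.
Qed.

Lemma runs_in_nil D t : runs_in PNil D 3 t.
Proof.
move=> n adj eG a rep Da /=; have : 0 < n.+1 ^ t by rewrite expn_gt0.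
by nia.
Qed.

Lemma elim_plan C t : eliminable e C t -> forall D, (forall j, j \in D -> j \notin C) ->
  exists p c, [/\ scoped (nats D) p, realizes p C D & runs_in p D c t].
Proof.
elim=> {C t}.
- move=> t D _; exists PNil, 3; split=> //; last exact: runs_in_nil.
  by move=> n adj eG a _ _ _; rewrite eqxx; split=> // f _; rewrite card_ext0.
- move=> A B t dAB nAB _ IHA _ IHB D dD.
  have [|p [c [sp rp cp]]] := IHA D; first by move=> j /dD; rewrite inE negb_or => /andP [].
  have [|q [c' [sq rq cq]]] := IHB D; first by move=> j /dD; rewrite inE negb_or => /andP [].
  exists (PSplit p q), (c + c' + 10); split; [by rewrite /= sp | | exact: runs_in_split].
  exact: realizes_split.
- move=> v C t Cv _ IH D dD.
  have [|p [c [sp rp cp]]] := IH (v :: D).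
    by move=> j; rewrite !inE => /orP [/eqP->|/dD jC]; rewrite ?eqxx // (negPf jC) andbF.
  exists (PVert v (nbrs v D) p), (120 + 50 * size D * dd.+1 + c).
  by split=> //; [apply: realizes_vert | apply: runs_in_vert].
- move=> v w C t Cv Cw evw _ IH D dD.
  have nwv : w != v by apply: contraTneq evw => ->; rewrite e_irr.
  have [|p [c [sp rp cp]]] := IH (w :: v :: D).
    move=> j; rewrite !inE => /or3P [/eqP->|/eqP->|/dD jC]; rewrite ?eqxx ?andbF //.
    by rewrite (negPf jC) !andbF.
  exists (PVert v (nbrs v D) (PNbr v w (nbrs w (v :: D)) p)),
    (140 + 50 * size D * dd.+1 + dd * (100 + 50 * (size D).+1 + c)).
  split; first by rewrite /= mem_head.
    apply: realizes_vert => //; apply: realizes_nbr; rewrite ?mem_head ?inE ?nwv //.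
    by move=> j; rewrite !inE => /orP [/eqP->|/dD jC]; rewrite ?eqxx // (negPf jC) andbF.
  exact: runs_in_edge.
Qed.

End Realize.

(** * Host graphs and linear combinations of counts *)

Lemma nth_flatten_take (T : Type) (x0 : T) (L : seq (seq T)) x i :
  x < size L -> i < size (nth [::] L x) ->
  nth x0 (flatten L) (sumn (map size (take x L)) + i) = nth x0 (nth [::] L x) i.
Proof.
elim: L x => // l L IH [|x] /= ltx lti; first by rewrite nth_cat lti.
by rewrite nth_cat -addnA ltnNge leq_addr /= addKn IH.
Qed.

Lemma size_uniq_card n (l : seq nat) : uniq l -> (forall x, x \in l -> x < n) ->
  size l = #|[set u : 'I_n | val u \in l]|.
Proof.
move=> ul ln; rewrite cardE -(size_map val); apply: perm_size; apply: uniq_perm => //.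
  by rewrite map_inj_uniq ?enum_uniq //; apply: val_inj.
move=> x; apply/idP/mapP => [xl|[u + ->]]; last by rewrite mem_enum inE.
by exists (Ordinal (ln x xl)) => //; rewrite mem_enum inE.
Qed.

(** Peeling: degeneracy of the subgraph induced on [S] gives a vertex of degree at most [d], whose
    removal costs at most 2d in [vol]. *)
Lemma degenerate_vol d (T : finType) (e : rel T) (S : {set T}) : simple_graph e ->
  degenerate d e -> vol e S <= 2 * d * #|S|.
Proof.
move=> [e_sym e_irr] dge; have [m] := ubnP #|S|; elim: m S => // m IH S ltSm.
case: (eqVneq S set0) => [->|S0]; first by rewrite vol0.
pose E' u v := [&& u \in S, v \in S & e u v].
have [||v vS] := dge S E' S0; first by move=> u v; rewrite /E' e_sym; case: (u \in S); case: (v \in S).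
  by [].
have -> : [set u in S | E' v u] = [set u in S | e v u].
  by apply/setP => u; rewrite !inE /E' vS; case: (u \in S).
rewrite -deg_card => dv; rewrite (volD1 e_sym e_irr vS) (cardsD1 v S) vS.
have le_S : #|S :\ v| < m by move: ltSm; rewrite (cardsD1 v S) vS.
have := IH _ le_S; move: (vol _ _) => x; rewrite mulnDr; lia.
Qed.

Section Encoding.
Variables (d n : nat) (eG : rel 'I_n) (inp : seq nat).
Hypotheses (sG : simple_graph eG) (dG : degenerate d eG).

Lemma encoding_host : adj_encoding eG inp -> exists adj,
  encodes (Host n adj) inp /\ represents (2 * d) adj eG.
Proof.
case=> L [szL LP defI]; exists (nth [::] L).
have Lu x : x < n -> uniq (nth [::] L x) by move=> xn; have [] := LP (Ordinal xn).
have Ll x y : x < n -> y \in nth [::] L x -> y < n.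
  by move=> xn; have [_ [H _]] := LP (Ordinal xn); apply: H.
have Lm (u v : 'I_n) : (val u \in nth [::] L (val v)) = eG v u by have [_ [_ ->]] := LP v.
pose A := [seq n + 2 + sumn (map size (take i L)) | i <- iota 0 n.+1].
have szA : size A = n.+1 by rewrite size_map size_iota.
have inpS i : nth 0 inp i.+1 = nth 0 (A ++ flatten L) i by rewrite defI.
have offE x : x <= n -> nth 0 inp (x + 1) = n + 2 + sumn (map size (take x L)).
  move=> xn; rewrite addn1 inpS nth_cat szA ltnS xn.
  by rewrite (nth_map 0) ?size_iota ?nth_iota.
have degE (v : 'I_n) : size (nth [::] L v) = deg eG setT v.
  rewrite deg_card (size_uniq_card (Lu _ (ltn_ord v)) (Ll _ ^~ (ltn_ord v))).
  by apply: eq_card => u; rewrite !inE Lm.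
have degn x : size (nth [::] L x) <= n.
  case: (ltnP x n) => [xn|nx]; last by rewrite nth_default ?szL.
  rewrite (degE (Ordinal xn)) deg_card -[X in _ <= X]card_ord; exact: max_card.
have sum_take x : sumn (map size (take x L)) <= n * n.
  have : sumn (map size (take x L)) <= size (take x L) * n.
    rewrite sumnE big_map; elim: (take x L) (mem_take (s := L) (n0 := x)) => [|l l' IH] sub.
      by rewrite big_nil.
    rewrite big_cons /= mulSn leq_add ?IH //; last by move=> z zl; apply: sub; rewrite inE zl orbT.
    have /(nthP [::]) [i _ <-] : l \in L by apply: sub; rewrite mem_head.
    exact: degn.
  move/leq_trans; apply; rewrite leq_mul2r -[X in _ <= X]szL size_take; case: ltnP; rewrite ?leqnn ?orbT //.
  by move=> /ltnW ->; rewrite orbT.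
split; first split=> //=.
- by rewrite defI.
- move=> x xn; rewrite (offE x) 1?ltnW // -[x + 2]/(x + (1 + 1)) addnA (addn1 x) offE //.
  by rewrite (take_nth [::]) ?szL // map_rcons -cats1 sumn_cat /= addn0 addnA.
- move=> x i xn ix; rewrite offE 1?ltnW //.
  have -> : n + 2 + sumn (map size (take x L)) + i = (n.+1 + (sumn (map size (take x L)) + i)).+1 by lia.
  by rewrite inpS nth_cat szA ltnNge leq_addr /= addKn nth_flatten_take ?szL.
(* Offsets are at most n + 2 + n * n; list entries are below n. *)
- case=> [|i]; first by rewrite defI /= expnS expn1; nia.
  rewrite inpS nth_cat szA; case: ltnP => [ltin|lein].
    rewrite (nth_map 0) ?size_iota ?nth_iota // add0n.
    by have := sum_take i; rewrite expnS expn1; nia.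
  case: (ltnP (i - n.+1) (size (flatten L))) => [lt_i|?]; last by rewrite nth_default.
  have /flattenP [l /(nthP [::]) [x xL <-] yl] := mem_nth 0 lt_i.
  rewrite szL in xL; apply: leq_trans (ltnW (Ll x _ xL yl)) _; rewrite expnS expn1; nia.
- split=> //.
  have -> : \sum_(x < n) size (nth [::] L x) = vol eG setT.
    by rewrite /vol; apply: eq_big => [x|x _]; rewrite ?inE ?degE.
  by have := degenerate_vol setT sG dG; rewrite cardsT card_ord.
Qed.

End Encoding.

(** Plays two roles: every vertex not yet placed has register 0, and that register contains the
    image 0 while plans run. *)
Definition env0 (_ : nat) := 0.

(** The assignment [x := x] stands for a skip. *)
Fixpoint sumc (ps : seq plan) x :=
  match ps with
  | [::] => Asg x (Var x)
  | p :: ps => Seq (Seq (pcode p env0 4) (Asg x (Bin OAdd (Var x) (Var 4)))) (sumc ps x)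
  end.

(** Positive and negative terms are summed apart, in registers 2 and 3, because partial alternating
    sums could be negative. Plans use registers from 4 on. *)
Definition combine pos neg q :=
  Seq (Asg 1 (Rd (Cst 0))) (Seq (sumc pos 2) (Seq (sumc neg 3)
    (Asg 0 (Bin ODiv (Bin OSub (Var 2) (Var 3)) (Cst q))))).

Lemma spec_sumc h inp W (I : eqType) (F : I -> plan) ps x s : encodes h inp ->
  (hn h).+2 ^ 3 <= W -> (x == 2) || (x == 3) -> s 0 = 0 -> s 1 = hn h ->
  (forall i, i \in ps -> scoped [::] (F i) /\ (hn h).+2 ^ (binders (F i) + 3) <= W) ->
  s x + \sum_(i <- ps) pval h (F i) env0 <= W ->
  spec W inp (sumc (map F ps) x) s (\sum_(i <- ps) (cost h (F i) env0 + 8) + 4)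
    (fun s' => (forall a, a < 4 -> a != x -> s' a = s a) /\
       s' x = s x + \sum_(i <- ps) pval h (F i) env0).
Proof.
move=> enc W_large x23; have x4 : x < 4 by case/orP: x23 => /eqP ->.
have x0 : 0 != x by case/orP: x23 => /eqP ->.
have x1 : 1 != x by case/orP: x23 => /eqP ->.
elim: ps s => [|i ps IH] s s0 s1 psP /=.
  rewrite !big_nil addn0 => sW; apply: spec_asg => //=; first by rewrite sW.
  split; last by rewrite upd_eq.
  by move=> a _ /eqP ax; rewrite upd_ne.
rewrite !big_cons => leW.
have [sp pW] := psP i (mem_head _ _).
apply: (@spec_seq _ _ _ _ _ (cost h (F i) env0 + 7) (\sum_(q <- ps) (cost h (F q) env0 + 8) + 4)); last by lia.
apply: (@spec_seq _ _ _ _ _ (cost h (F i) env0) 7) => //.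
apply: spec_weak (@computes_pcode h inp W enc W_large (F i) env0 4 s [::] env0 _ _ _ _ s1 sp _ pW) (leqnn _) _ => //.
move=> s2 [fr2 s2r]; apply: spec_asg => //=.
  by rewrite fr2 // s2r; lia.
set s3 := upd s2 x _.
have s3x : s3 x = s x + pval h (F i) env0 by rewrite /s3 upd_eq s2r fr2.
have fr3 a : a < 4 -> a != x -> s3 a = s a.
  by move=> a4 /eqP ax; rewrite /s3 upd_ne // fr2.
apply: spec_weak (IH s3 _ _ _ _) (leqnn _) _.
- by rewrite fr3.
- by rewrite fr3.
- by move=> q qps; apply: psP; rewrite inE qps orbT.
- by rewrite s3x -addnA.
move=> s4 [fr4 s4x]; split; last by rewrite s4x s3x addnA.
by move=> a a4 ax; rewrite fr4 ?fr3.
Qed.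

Lemma sscope_bound c : exists K, forall K', K <= K' -> sscope K' c.
Proof.
have ebound e : exists K, forall K', K <= K' -> escope K' e.
  elim: e => [x|m|e [K HK]|o e1 [K1 H1] e2 [K2 H2]].
  - by exists x.+1.
  - by exists 0.
  - by exists K.
  - by exists (K1 + K2) => K' le /=; rewrite H1 ?H2; lia.
elim: c => [x e|c1 [K1 H1] c2 [K2 H2]|x c [K H]].
- by have [K HK] := ebound e; exists (x.+1 + K) => K' le /=; rewrite HK; lia.
- by exists (K1 + K2) => K' le /=; rewrite H1 ?H2; lia.
- by exists (x.+1 + K) => K' le /=; rewrite H; lia.
Qed.

(** Crude, but enough for a word-size exponent independent of the host. *)
Lemma sum_pow (I : eqType) m (ps : seq I) (F b : I -> nat) : 1 < m ->
  (forall i, i \in ps -> F i <= m ^ b i) ->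
  \sum_(i <- ps) F i <= m ^ (\sum_(i <- ps) (b i).+1).
Proof.
move=> m1; elim: ps => [|p ps IH] Fp; first by rewrite !big_nil.
rewrite !big_cons; set c := \sum_(q <- ps) (b q).+1.
have le_p := Fp p (mem_head _ _).
have le_ps : \sum_(q <- ps) F q <= m ^ c by apply: IH => q qps; apply: Fp; rewrite inE qps orbT.
rewrite addSn expnS expnD.
have p1 : 0 < m ^ b p by rewrite expn_gt0; lia.
have b1 : 0 < m ^ c by rewrite expn_gt0; lia.
have : 2 * (m ^ b p * m ^ c) <= m * (m ^ b p * m ^ c) by rewrite leq_mul2r m1 orbT.
move: (m ^ b p) (m ^ c) p1 b1 le_p le_ps => u w *; nia.
Qed.

Lemma common_bound (T : eqType) (ps : seq T) (R : T -> nat -> Prop) :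
  (forall p c c', R p c -> c <= c' -> R p c') ->
  (forall p, p \in ps -> exists c, R p c) -> exists c, forall p, p \in ps -> R p c.
Proof.
move=> Rmono; elim: ps => [|p ps IH] Rps; first by exists 0.
have [c Rc] := Rps p (mem_head _ _).
have [|c' Rc'] := IH; first by move=> q qps; apply: Rps; rewrite inE qps orbT.
exists (c + c') => q; rewrite inE => /orP [/eqP->|/Rc' Rq].
  by apply: Rmono Rc _; apply: leq_addr.
by apply: Rmono Rq _; apply: leq_addl.
Qed.

Lemma run_combine k dd t (I : eqType) (F : I -> plan) pos neg q :
  (forall i, i \in pos ++ neg -> scoped [::] (F i) /\
     exists c, @runs_in k dd (F i) [::] c t) ->
  exists P c0, forall c n inp adj (eG : rel 'I_n), c0 <= c ->
    encodes (Host n adj) inp -> represents dd adj eG ->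
    run c (n.+2 ^ c) inp P (c * n.+1 ^ t) =
      Some ((\sum_(i <- pos) pval (Host n adj) (F i) env0 -
             \sum_(i <- neg) pval (Host n adj) (F i) env0) %/ q).
Proof.
move=> good; have [c1 runs] : exists c, forall i, i \in pos ++ neg -> @runs_in k dd (F i) [::] c t.
  apply: common_bound => [i c c' ri le_c|i /good []] //.
  move=> n adj eG a rep Da; apply: leq_trans (ri n adj eG a rep Da) _.
  by rewrite leq_mul2r le_c orbT.
set code := combine (map F pos) (map F neg) q.
have [K HK] := sscope_bound code.
set b := \sum_(i <- pos ++ neg) (binders (F i)).+1.
exists (scomp K.+1 code 0 ++ [:: IHalt]).
(* One constant serves as space bound, word-size exponent and time factor, so all demands are added
   up. *)
exists (K.+1 + scost code + b + 3 + q + 32 + size (pos ++ neg) * (c1 + 8)).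
move=> c n inp adj eG le_c enc rep.
set h := Host n adj; set W := n.+2 ^ c.
have n2 : 1 < n.+2 by [].
have W3 : n.+2 ^ 3 <= W by rewrite leq_exp2l //; lia.
have W2 : n.+2 ^ 2 <= W by rewrite leq_exp2l //; lia.
have Wq : q <= W by apply: leq_trans (ltnW (ltn_expl q n2)) _; rewrite leq_exp2l //; lia.
have ncat : \sum_(i <- pos ++ neg) pval h (F i) env0 <= W.
  apply: (@leq_trans (n.+2 ^ b)); last by rewrite leq_exp2l //; lia.
  apply: sum_pow => // i /good [sc _].
  apply: leq_trans (pval_leq enc sc _) _ => //=.
  by case: (binders _) => // m; rewrite leq_exp2r.
rewrite big_cat /= in ncat.
have bW i : i \in pos ++ neg -> scoped [::] (F i) /\ (hn h).+2 ^ (binders (F i) + 3) <= W.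
  move=> ip; have [sc _] := good i ip; split=> //.
  rewrite leq_exp2l //=; have : (binders (F i)).+1 <= b by rewrite /b (big_rem i) //= leq_addr.
  by lia.
have costi i : i \in pos ++ neg -> cost h (F i) env0 <= c1 * n.+1 ^ t.
  by move=> ip; apply: runs rep _.
set q1 := n.+1 ^ t in costi *; have q1_gt0 : 0 < q1 by rewrite expn_gt0.
have costs l : {subset l <= pos ++ neg} ->
    \sum_(i <- l) (cost h (F i) env0 + 8) <= size l * ((c1 + 8) * q1).
  elim: l => [|i l IH] sub; first by rewrite big_nil.
  rewrite big_cons /= mulSn leq_add ?IH //; last by move=> j jl; apply: sub; rewrite inE jl orbT.
  by have := costi i (sub i (mem_head _ _)); nia.
have cp : \sum_(i <- pos) (cost h (F i) env0 + 8) <= size pos * ((c1 + 8) * q1).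
  by apply: costs => i ip; rewrite mem_cat ip.
have cn : \sum_(i <- neg) (cost h (F i) env0 + 8) <= size neg * ((c1 + 8) * q1).
  by apply: costs => i ip; rewrite mem_cat ip orbT.
have [s [u [le_u evs s0]]] : spec W inp code (fun _ => 0)
    (size pos * ((c1 + 8) * q1) + size neg * ((c1 + 8) * q1) + 30)
    (fun s => s 0 = (\sum_(i <- pos) pval h (F i) env0 - \sum_(i <- neg) pval h (F i) env0) %/ q).
  apply: (@spec_seq _ _ _ _ _ 4 (size pos * ((c1 + 8) * q1) + size neg * ((c1 + 8) * q1) + 20)); last by lia.
  apply: spec_asg => //; first by rewrite /= andbT; apply: leq_trans (enc_small enc 0) W2.
  set s1 := upd _ _ _; have s1n : s1 1 = n by rewrite /s1 upd_eq /= (enc_n enc).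
  apply: (@spec_seq _ _ _ _ _ (size pos * ((c1 + 8) * q1) + 4) (size neg * ((c1 + 8) * q1) + 15)); last by lia.
  have i1 a : a != 1 -> s1 a = 0 by move=> /eqP a1; rewrite /s1 upd_ne.
  apply: spec_weak (@spec_sumc h inp W _ F pos 2 s1 enc W3 _ _ s1n _ _) _ _ => //.
  - by move=> i ip; apply: bW; rewrite mem_cat ip.
  - by rewrite i1 // add0n; apply: leq_trans (leq_addr _ _) ncat.
  - by rewrite leq_add2r.
  move=> s2 [fr2 s2x].
  apply: (@spec_seq _ _ _ _ _ (size neg * ((c1 + 8) * q1) + 4) 11); last by lia.
  apply: spec_weak (@spec_sumc h inp W _ F neg 3 s2 enc W3 _ _ _ _ _) _ _ => //.
  - by rewrite fr2 // i1.
  - by rewrite fr2.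
  - by move=> i ip; apply: bW; rewrite mem_cat ip orbT.
  - by rewrite fr2 // i1 // add0n; apply: leq_trans (leq_addl _ _) ncat.
  - by rewrite leq_add2r.
  move=> s3 [fr3 s3x].
  have s32 : s3 2 = \sum_(i <- pos) pval h (F i) env0 by rewrite fr3 // s2x i1.
  have s33 : s3 3 = \sum_(i <- neg) pval h (F i) env0 by rewrite s3x fr2 // i1.
  apply: spec_asg => //=; last by rewrite upd_eq s32 s33.
  rewrite s32 s33 Wq.
  move: (\sum_(i <- pos) _) (\sum_(i <- neg) _) ncat => x y ncat.
  have : (x - y) %/ q <= x - y by apply: leq_div.
  by move=> le1; rewrite !andbT; lia.
rewrite (run_scomp evs) ?s0 //.
- by apply: HK.
- by lia.
- move: le_c; rewrite size_cat => le_c.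
  have : (size pos + size neg) * (c1 + 8) + 32 <= c by lia.
  move=> le_c'; apply: (@leq_trans (((size pos + size neg) * (c1 + 8) + 32) * q1)); last by rewrite leq_mul2r le_c' orbT.
  by rewrite mulnDl -mulnA mulnDl; lia.
Qed.

(** * Quotients and injective homomorphisms *)

Lemma vol_setT (T : finType) (g : rel T) : vol g setT = #|[set p : T * T | g p.1 p.2]|.
Proof.
rewrite /vol /deg pair_big /= -sum1_card [RHS]big_mkcond /= big_mkcond /=.
by apply: eq_bigr => p _; rewrite !inE /=; case: (g _ _).
Qed.

Lemma vol_nedges k (e : rel 'I_k) : simple_graph e -> vol e setT = 2 * nedges e.
Proof.
move=> [e_sym e_irr]; rewrite vol_setT.
pose swap (p : 'I_k * 'I_k) := (p.2, p.1).
have swapK : cancel swap swap by case.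
rewrite mul2n -addnn -(cardsID [set p : 'I_k * 'I_k | p.1 < p.2]); congr (_ + _).
  by apply: eq_card => p; rewrite !inE andbC.
apply: etrans (card_imset _ (can_inj swapK)).
apply: eq_card => p; rewrite !inE; apply/andP/imsetP => [[lep ep]|[p' + ->]].
  exists (swap p); last by rewrite swapK.
  rewrite inE /= e_sym ep andbT ltn_neqAle leqNgt lep andbT.
  by apply: contraTneq ep => /val_inj <-; rewrite e_irr.
by rewrite inE => /andP [ltp ep] /=; rewrite e_sym ep -leqNgt ltnW.
Qed.

Section Quotient.
Variables (k : nat) (e : rel 'I_k) (A : {set 'I_k * 'I_k}).
Hypotheses (sH : simple_graph e).

Definition link : rel 'I_k := fun x y => ((x, y) \in A) || ((y, x) \in A).
Definition rep (x : 'I_k) := root link x.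
(** H/A lives on ['I_k] itself, its vertices being the chosen class representatives; only these, the
    set [reps], are to be eliminated. *)
Definition quotient_rel : rel 'I_k :=
  fun x y => [exists i, exists j, [&& rep i == x, rep j == y & e i j]].
Definition reps := [set x | rep x == x].
(** An edge inside a class becomes a loop of H/A; such an [A] contributes 0 and is dropped from the
    sums. *)
Definition collapses := [exists i, exists j, e i j && (rep i == rep j)].

Lemma link_sym : connect_sym link.
Proof. by apply: sym_connect_sym => x y; rewrite /link orbC. Qed.

Lemma rep_rep x : rep (rep x) = rep x.
Proof. exact: root_root link_sym x. Qed.

Lemma quotient_simple : ~~ collapses -> simple_graph quotient_rel.
Proof.
case: sH => e_sym e_irr /existsPn ncol; split.
  move=> x y; apply/existsP/existsP => -[i /existsP [j /and3P [xi yj eij]]];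
    by exists j; apply/existsP; exists i; rewrite xi yj e_sym.
move=> x; apply/negbTE/existsPn => i; apply/existsPn => j.
have /existsPn/(_ j) := ncol i; apply: contraNN => /and3P [/eqP -> /eqP -> ->].
by rewrite eqxx.
Qed.

(** Every edge of H/A is the image of an edge of H, so no quotient has a larger time exponent than
    H. *)
Lemma quotient_vol : ~~ collapses -> vol quotient_rel reps <= vol e setT.
Proof.
move=> ncol; have sQ := quotient_simple ncol; have [q_sym q_irr] := sQ.
apply: leq_trans (leq_vol q_sym (subsetT _)) _.
rewrite !vol_setT.
apply: leq_trans (leq_imset_card (fun p => (rep p.1, rep p.2)) _).
apply: subset_leq_card; apply/subsetP => [[x y]]; rewrite inE /=.
case/existsP => i /existsP [j /and3P [/eqP <- /eqP <- eij]].
by apply/imsetP; exists (i, j); rewrite ?inE.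
Qed.

Variables (n : nat) (eG : rel 'I_n).
Hypothesis sG : simple_graph eG.

Definition homs : {set {ffun 'I_k -> 'I_n}} :=
  [set phi : {ffun 'I_k -> 'I_n} | [forall i, forall j, e i j ==> eG (phi i) (phi j)]].

Definition glued (phi : {ffun 'I_k -> 'I_n}) := [forall p in A, phi p.1 == phi p.2].

Lemma homsP (phi : {ffun 'I_k -> 'I_n}) : reflect (forall i j, e i j -> eG (phi i) (phi j)) (phi \in homs).
Proof.
rewrite inE; apply: (iffP forallP) => [H i j|H i].
  by have /forallP/(_ j)/implyP := H i.
by apply/forallP => j; apply/implyP; apply: H.
Qed.

Lemma glued_rep (phi : {ffun 'I_k -> 'I_n}) x : glued phi -> phi (rep x) = phi x.
Proof.
move=> /forall_inP gl; have : connect link x (rep x) by apply: connect_root.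
case/connectP => p + ->; elim: p x => //= y p IH x /andP [lxy pth].
rewrite IH //; case/orP: lxy => /gl /eqP //=.
Qed.

Lemma rep_glued (phi : {ffun 'I_k -> 'I_n}) : (forall x, phi (rep x) = phi x) -> glued phi.
Proof.
move=> H; apply/forall_inP => [[x y]] /= xy; rewrite -(H x) -(H y).
suff -> : rep x = rep y by [].
by apply/eqP; rewrite root_connect ?connect1 /link ?xy //; apply: link_sym.
Qed.

Lemma card_collapses : collapses -> #|[set phi in homs | glued phi]| = 0.
Proof.
case/existsP => i /existsP [j /andP [eij /eqP ij]].
apply/eqP; rewrite cards_eq0; apply/eqP/setP => phi; rewrite in_set0 in_set.
apply/negP => /andP [/homsP H gl].
by have := H i j eij; rewrite -(glued_rep i gl) -(glued_rep j gl) ij (proj2 sG).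
Qed.

(** A map glued along [A] is constant on classes, hence determined on [reps]; on the other side the
    values off [reps] are frozen to [f]. *)
Lemma card_glued f : #|[set phi in homs | glued phi]| = #|ext quotient_rel eG reps [::] f|.
Proof.
pose F (g : {ffun 'I_k -> 'I_n}) : {ffun 'I_k -> 'I_n} := [ffun i => g (rep i)].
have repsP x : reflect (rep x = x) (x \in reps) by rewrite inE; apply: eqP.
apply: esym; rewrite -(card_in_imset (f := F)); last first.
  move=> g h /extP [gf _] /extP [hf _] /ffunP eqF; apply/ffunP => x.
  case: (repsP x) => [xr|/repsP nx]; last by rewrite gf ?hf.
  by have := eqF x; rewrite !ffunE xr.
apply: eq_card => phi; apply: esym; rewrite in_set.
apply/andP/imsetP => [[/homsP H gl]|[g /extP [gf gE] ->]].
  exists [ffun x => if x \in reps then phi x else f x].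
    apply/extP; split=> [x xr|x y xr]; first by rewrite ffunE (negPf xr).
    rewrite orbF => yr /existsP [i /existsP [j /and3P [/eqP xi /eqP yj eij]]].
    by rewrite !ffunE xr yr -xi -yj !glued_rep // H.
  apply/ffunP => x; rewrite !ffunE; case: repsP => [_|[]]; last exact: rep_rep.
  by rewrite glued_rep.
split; last by apply: rep_glued => x; rewrite !ffunE rep_rep.
apply/homsP => i j eij; rewrite !ffunE; apply: gE.
- by apply/repsP; rewrite rep_rep.
- by rewrite orbF; apply/repsP; rewrite rep_rep.
- by apply/existsP; exists i; apply/existsP; exists j; rewrite !eqxx.
Qed.

Lemma card_glued_n0 : n = 0 -> #|[set phi in homs | glued phi]| = (reps == set0).
Proof.
move=> n0; case: (set_0Vmem reps) => [r0|[x xr]].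
  have nok (x : 'I_k) : False.
    have : rep x \in reps by rewrite inE rep_rep.
    by rewrite r0 inE.
  pose f0 : {ffun 'I_k -> 'I_n} := [ffun x => False_rect 'I_n (nok x)].
  rewrite r0 eqxx; apply: etrans (cards1 f0); apply: eq_card => phi; rewrite in_set in_set1.
  have -> : phi = f0 by apply/ffunP => x; case: (nok x).
  rewrite eqxx; apply/andP; split; first by apply/homsP => x; case: (nok x).
  by apply/forall_inP => [[x y]]; case: (nok x).
have -> : (reps == set0) = false by apply/negbTE/set0Pn; exists x.
apply/eqP; rewrite cards_eq0; apply/eqP/setP => phi; rewrite in_set0.
by have := leq_trans (ltn_ord (phi x)) (eq_leq n0).
Qed.

End Quotient.

(** * Inclusion-exclusion and automorphisms *)

Section Parity.
Variable T : finType.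

(** Toggling one fixed element of a nonempty [E] matches even subsets with odd ones; the additive
    form avoids signs. *)
Lemma card_even_subsets (E : {set T}) :
  #|[set A : {set T} | (A \subset E) && ~~ odd #|A|]| =
  (E == set0) + #|[set A : {set T} | (A \subset E) && odd #|A|]|.
Proof.
case: (set_0Vmem E) => [->|[x xE]].
  have -> : [set A : {set T} | (A \subset set0) && ~~ odd #|A|] = [set set0].
    by apply/setP => A; rewrite !inE subset0; case: eqP => [->|]; rewrite ?cards0.
  have -> : [set A : {set T} | (A \subset set0) && odd #|A|] = set0.
    by apply/setP => A; rewrite !inE subset0; case: eqP => [->|]; rewrite ?cards0.
  by rewrite eqxx cards1 cards0.
have -> : (E == set0) = false by apply/negbTE/set0Pn; exists x.
pose flip (A : {set T}) := if x \in A then A :\ x else x |: A.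
have flipK : involutive flip.
  move=> A; rewrite /flip; case: (boolP (x \in A)) => xA; first by rewrite setD11 setD1K.
  by rewrite setU11 setU1K.
have flip_odd A : odd #|flip A| = ~~ odd #|A|.
  rewrite /flip; case: (boolP (x \in A)) => xA; last by rewrite cardsU1 xA.
  by rewrite (cardsD1 x A) xA /= negbK.
have flip_sub A : (flip A \subset E) = (A \subset E).
  rewrite /flip; case: (boolP (x \in A)) => xA; last by rewrite subUset sub1set xE.
  by rewrite -{2}(setD1K xA) subUset sub1set xE.
rewrite add0n -(card_imset _ (inv_inj flipK)); apply: eq_card => A.
apply/imsetP/idP => [[B + ->]|]; rewrite !inE; first by rewrite flip_sub flip_odd.
move=> /andP [sA oA]; exists (flip A); last by rewrite flipK.
by rewrite !inE flip_sub flip_odd negbK sA.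
Qed.

End Parity.

Section Injective.
Variables (k n : nat) (e : rel 'I_k) (eG : rel 'I_n).
Hypotheses (sH : simple_graph e) (sG : simple_graph eG).
Local Notation fT := {ffun 'I_k -> 'I_n}.

Definition increasing : {set 'I_k * 'I_k} := [set p : 'I_k * 'I_k | p.1 < p.2].

Definition coincidences (phi : fT) := [set p in increasing | phi p.1 == phi p.2].

Lemma coincidences0 (phi : fT) : (coincidences phi == set0) = injectiveb phi.
Proof.
apply/eqP/injectiveP => [c0 i j eq_ij|inj]; last first.
  apply/setP => [[i j]]; rewrite !inE /=; apply/negP => /andP [lt_ij /eqP/inj eq_ij].
  by rewrite eq_ij ltnn in lt_ij.
have no p : p \notin coincidences phi by rewrite c0 inE.
apply/val_inj/eqP; case: ltngtP => // lt.
  by have := no (i, j); rewrite !inE /= lt eq_ij eqxx.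
by have := no (j, i); rewrite !inE /= lt eq_ij eqxx.
Qed.

Lemma glued_coincidences (phi : fT) (A : {set 'I_k * 'I_k}) :
  (A \subset coincidences phi) = (A \subset increasing) && glued A phi.
Proof.
apply/subsetP/andP => [sA|[/subsetP sA /forall_inP gl] p pA]; last first.
  by have := gl p pA; have := sA p pA; rewrite !inE => -> ->.
split; first by apply/subsetP => p /sA; rewrite inE => /andP [].
by apply/forall_inP => p /sA; rewrite inE => /andP [].
Qed.

Lemma sum_glued (P : pred {set 'I_k * 'I_k}) :
  \sum_(A : {set 'I_k * 'I_k} | (A \subset increasing) && P A) #|[set phi in homs e eG | glued A phi]| =
  \sum_(phi in homs e eG) #|[set A : {set 'I_k * 'I_k} | (A \subset coincidences phi) && P A]|.
Proof.
transitivity (\sum_(A : {set 'I_k * 'I_k} | (A \subset increasing) && P A)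
  \sum_(phi in homs e eG) glued A phi).
  by apply: eq_bigr => A _; rewrite -sum1dep_card big_mkcondr.
rewrite exchange_big /=; apply: eq_bigr => phi _.
rewrite -big_mkcondr /= sum1dep_card; apply: eq_card => A; rewrite !inE glued_coincidences.
by rewrite -!andbA; congr (_ && _); rewrite andbC.
Qed.

(** Each homomorphism is counted once per subset of its coincidence set. Even and odd subsets cancel
    unless that set is empty, so the truncated difference is exact. *)
Lemma card_inj_homs :
  #|[set phi in homs e eG | injectiveb phi]| =
  \sum_(A : {set 'I_k * 'I_k} | (A \subset increasing) && ~~ odd #|A|) #|[set phi in homs e eG | glued A phi]| -
  \sum_(A : {set 'I_k * 'I_k} | (A \subset increasing) && odd #|A|) #|[set phi in homs e eG | glued A phi]|.
Proof.
rewrite (sum_glued (fun A => ~~ odd #|A|)) (sum_glued (fun A => odd #|A|)).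
rewrite (eq_bigr (fun phi : fT => injectiveb phi +
  #|[set A : {set 'I_k * 'I_k} | (A \subset coincidences phi) && odd #|A|]|)); last first.
  by move=> phi _; rewrite card_even_subsets coincidences0.
rewrite big_split /= addnK -sum1dep_card big_mkcondr /=.
by apply: eq_bigr => phi _; case: (injectiveb phi).
Qed.

Definition auts : {set {ffun 'I_k -> 'I_k}} :=
  [set s : {ffun 'I_k -> 'I_k} | injectiveb s && [forall i, forall j, e (s i) (s j) == e i j]].

Lemma auts_gt0 : 0 < #|auts|.
Proof.
apply/card_gt0P; exists [ffun i => i]; rewrite inE; apply/andP; split.
  by apply/injectiveP => i j; rewrite !ffunE.
by apply/forallP => i; apply/forallP => j; rewrite !ffunE.
Qed.

Definition image_of (phi : fT) : {set 'I_n} * {set {set 'I_n}} :=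
  (phi @: setT, [set [set phi p.1; phi p.2] | p in [set p : 'I_k * 'I_k | e p.1 p.2]]).

Lemma set2_inj (T : finType) (a b c d : T) : [set a; b] = [set c; d] ->
  (a = c /\ b = d) \/ (a = d /\ b = c).
Proof.
move=> eq; have := set21 a b; rewrite eq => /set2P aP; have := set22 a b; rewrite eq => /set2P bP.
have := set21 c d; rewrite -eq => /set2P cP; have := set22 c d; rewrite -eq => /set2P dP.
case: aP bP cP dP => [->|->] [->|->] [H|H] [H'|H']; subst; by [left|right].
Qed.

Lemma image_edge (phi : fT) i j : injective phi ->
  ([set phi i; phi j] \in (image_of phi).2) = e i j.
Proof.
have [e_sym _] := sH; move=> inj; apply/imsetP/idP => [[[x y]]|eij]; last by exists (i, j); rewrite ?inE.
rewrite inE /= => exy /set2_inj [] [/inj -> /inj ->] //; by rewrite e_sym.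
Qed.

Lemma image_sub_iso (phi : fT) : phi \in homs e eG -> injectiveb phi ->
  sub_iso e eG (image_of phi).
Proof.
move=> /homsP H inj; apply/andP; split.
  apply/forall_inP => F /imsetP [[i j]]; rewrite inE /= => eij ->.
  apply/existsP; exists (phi i); apply/existsP; exists (phi j).
  by rewrite H // eqxx /= !imset_f ?inE.
apply/existsP; exists phi; rewrite inj eqxx /=.
apply/forallP => i; apply/forallP => j; apply/eqP/image_edge; exact/injectiveP.
Qed.

(** Two embeddings with the same image differ by a unique automorphism, the inverse of [phi0] after
    [phi]. *)
Lemma fiber_auts (phi0 : fT) : phi0 \in homs e eG -> injectiveb phi0 ->
  #|[set phi in homs e eG | injectiveb phi && (image_of phi == image_of phi0)]| = #|auts|.
Proof.
move=> hom0 /injectiveP inj0.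
pose F (s : {ffun 'I_k -> 'I_k}) : fT := [ffun i => phi0 (s i)].
rewrite -(card_imset (f := F) auts); last first.
  by move=> s t /ffunP eqF; apply/ffunP => i; apply: inj0; have := eqF i; rewrite !ffunE.
apply: eq_card => phi; rewrite in_set; apply/and3P/imsetP => [[hom_phi inj_phi /eqP im]|[s + ->]].
  have injP := elimT (injectiveP phi) inj_phi.
  have ex i : exists j, phi0 j == phi i.
    have : phi i \in phi0 @: setT.
      by have [<- _] := im; rewrite imset_f ?inE.
    by case/imsetP => j _ ->; exists j.
  pose s : {ffun 'I_k -> 'I_k} := [ffun i => xchoose (ex i)].
  have sE i : phi0 (s i) = phi i by rewrite ffunE; apply/eqP; apply: (xchooseP (ex i)).
  exists s; last by apply/ffunP => i; rewrite ffunE sE.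
  rewrite inE; apply/andP; split.
    by apply/injectiveP => i j eq_s; apply: injP; rewrite -!sE eq_s.
  apply/forallP => i; apply/forallP => j; apply/eqP.
  by rewrite -(image_edge _ _ inj0) -(image_edge i j injP) im !sE.
rewrite inE => /andP [/injectiveP inj_s /forallP aut].
have autE i j : e (s i) (s j) = e i j by have /forallP/(_ j)/eqP := aut i.
have injF : injective (F s) by move=> i j; rewrite !ffunE => /inj0/inj_s.
have sK : bijective s by apply: injF_bij.
split; first by apply/homsP => i j eij; rewrite !ffunE; apply: (elimT (homsP _ _ _) hom0); rewrite autE.
  exact/injectiveP.
apply/eqP; case: sK => t sK tK; congr pair; apply/setP => x.
  apply/imsetP/imsetP => [[i _ ->]|[i _ ->]].
    by exists (s i); rewrite ?ffunE.
  by exists (t i); rewrite ?ffunE ?tK.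
apply/imsetP/imsetP => [[[i j]]|[[i j]]]; rewrite inE /= => eij ->.
  exists (s i, s j); first by rewrite inE /= autE.
  by rewrite !ffunE.
exists (t i, t j); first by rewrite inE /= -autE !tK.
by rewrite !ffunE !tK.
Qed.

Lemma sub_iso_image SF : sub_iso e eG SF ->
  exists phi, [/\ phi \in homs e eG, injectiveb phi & image_of phi = SF].
Proof.
have [eG_sym eG_irr] := sG.
case: SF => S F /andP [/= /forall_inP FE /existsP [phi /and3P [inj /eqP imS /forallP edge]]].
have edgeE i j : ([set phi i; phi j] \in F) = e i j by have /forallP/(_ j)/eqP := edge i.
exists phi; split=> //.
  apply/homsP => i j; rewrite -edgeE => /FE /existsP [u /existsP [v /and4P [uv /eqP eq _ _]]].
  by case/set2_inj: eq => [] [-> ->]; rewrite // eG_sym.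
rewrite /image_of imS; congr pair; apply/setP => X; apply/imsetP/idP => [[[i j]]|XF].
  by rewrite inE /= -edgeE => ? ->.
have /existsP [u /existsP [v /and4P [uv /eqP XE uS vS]]] := FE X XF.
move: uS vS; rewrite -imS => /imsetP [i _ ui] /imsetP [j _ vj].
by exists (i, j); rewrite ?inE /= -?edgeE -ui -vj -?XE.
Qed.

Lemma card_inj_homs_sub :
  #|[set phi in homs e eG | injectiveb phi]| = sub e eG * #|auts|.
Proof.
rewrite -sum1_card (partition_big image_of (fun SF => SF \in [set SF | sub_iso e eG SF])) /=; last first.
  by move=> phi; rewrite !inE => /andP [hom_phi inj]; apply: image_sub_iso; rewrite ?inE.
rewrite /sub -sum_nat_const; apply: eq_bigr => SF; rewrite inE => /sub_iso_image [phi0 [hom0 inj0 <-]].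
rewrite sum1dep_card -(fiber_auts hom0 inj0); apply: eq_card => phi.
by rewrite in_set [RHS]in_set in_set andbA.
Qed.

End Injective.

(** * Assembly of the two programs *)

Section Main.
Variables (d k : nat) (e : rel 'I_k).
Hypothesis sH : simple_graph e.

(** The existential stands outside the implication so that a plan can be chosen for every [A] at
    once; collapsing sets receive a dummy. *)
Lemma quotient_plan (A : {set 'I_k * 'I_k}) : exists p, ~~ collapses e A ->
  (scoped [::] p /\ exists c, @runs_in k (2 * d) p [::] c (nedges e %/ 5 + 3)) /\
  forall n adj (eG : rel 'I_n), simple_graph eG -> represents (2 * d) adj eG ->
    pval (Host n adj) p env0 = #|[set phi in homs e eG | glued A phi]|.
Proof.
case: (boolP (collapses e A)) => [|ncol]; first by exists PNil.
have [q_sym q_irr] := quotient_simple sH ncol.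
have le_t : vol (quotient_rel e A) (reps A) %/ 10 + 3 <= nedges e %/ 5 + 3.
  (* [vol] counts each edge twice, which turns the division by 10 into one by 5. *)
  rewrite leq_add2r -(@divnMl 2 (nedges e)) // -vol_nedges //.
  by apply: leq_div2r; apply: quotient_vol.
have el := elim_mono le_t (vol_elim q_sym q_irr (reps A)).
have [|p [c [sp rp cp]]] := @elim_plan k (2 * d) _ q_sym q_irr _ _ el [::]; first by [].
exists p => _; split; first by split=> //; exists c.
move=> n adj eG sG rep; have [eG_sym _] := sG.
have in0 : in_range (Host n adj) (nats ([::] : seq 'I_k)) env0 by [].
have [rp0 rpf] := rp n adj eG env0 eG_sym rep in0.
case: (posnP n) => [n0|n_gt0]; first by rewrite rp0 // card_glued_n0.
pose f : {ffun 'I_k -> 'I_n} := [ffun=> Ordinal n_gt0].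
by rewrite (card_glued _ _ _ f) (rpf f).
Qed.

(** Holding for every [c] above [c0], the bounds can later share one constant among all patterns. *)
Lemma programs : exists c0 Phom Psub, forall c n (eG : rel 'I_n) inp, c0 <= c ->
  simple_graph eG -> degenerate d eG -> adj_encoding eG inp ->
  run c (n.+2 ^ c) inp Phom (c * n.+1 ^ (nedges e %/ 5 + 3)) = Some (hom e eG) /\
  run c (n.+2 ^ c) inp Psub (c * n.+1 ^ (nedges e %/ 5 + 3)) = Some (sub e eG).
Proof.
have [F FP] := fin_all_exists quotient_plan.
pose terms (P : pred {set 'I_k * 'I_k}) := [seq A <- enum {set 'I_k * 'I_k} | P A && ~~ collapses e A].
have goodT P Q A : A \in terms P ++ terms Q -> scoped [::] (F A) /\
    exists c, @runs_in k (2 * d) (F A) [::] c (nedges e %/ 5 + 3).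
  by rewrite mem_cat !mem_filter => /orP [] /andP [/andP [_ /FP []]].
have termsE P n adj (eG : rel 'I_n) : simple_graph eG -> represents (2 * d) adj eG ->
    \sum_(A <- terms P) pval (Host n adj) (F A) env0 =
    \sum_(A : {set 'I_k * 'I_k} | P A) #|[set phi in homs e eG | glued A phi]|.
  move=> sG rep; rewrite big_filter big_enum_cond /=.
  rewrite [RHS](bigID (fun A => collapses e A)) /= [X in X + _]big1 ?add0n.
    by apply: eq_bigr => A /andP [_ /FP [_]]; apply.
  by move=> A /andP [_ col]; apply: card_collapses.
(* [hom] is the single term [A = set0], with nothing to subtract and divisor 1. *)
have [Phom [c1 H1]] := run_combine 1 (goodT (pred1 set0) pred0).
pose even (A : {set 'I_k * 'I_k}) := (A \subset increasing k) && ~~ odd #|A|.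
pose odds (A : {set 'I_k * 'I_k}) := (A \subset increasing k) && odd #|A|.
have [Psub [c2 H2]] := run_combine #|auts e| (goodT even odds).
exists (c1 + c2), Phom, Psub => c n eG inp le_c sG dG /(encoding_host sG dG) [adj [enc rep]].
rewrite (H1 c n inp adj eG) // ?(H2 c n inp adj eG) //; try lia.
rewrite !(termsE _ _ _ _ sG rep); split; congr Some.
  rewrite big_pred1_eq big_pred0 // subn0 divn1; apply: eq_card => phi.
  rewrite in_set -[RHS]andbT; congr (_ && _).
  by apply/forall_inP => p; rewrite inE.
by rewrite -card_inj_homs card_inj_homs_sub // mulnK // auts_gt0.
Qed.

End Main.

Theorem mainTheorem12 :
  exists f : nat -> nat -> nat,
  forall (d k : nat) (eH : rel 'I_k), simple_graph eH ->
  exists Phom Psub : seq instr,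
  forall (n : nat) (eG : rel 'I_n) (inp : seq nat),
    simple_graph eG -> degenerate d eG -> adj_encoding eG inp ->
    let T := f k d * n.+1 ^ (nedges eH %/ 5 + 3) in
    let S := f k d in
    let W := n.+2 ^ f k d in
    run S W inp Phom T = Some (hom eH eG) /\
    run S W inp Psub T = Some (sub eH eG).
Proof.
suff H k d : exists c, forall (eH : rel 'I_k), simple_graph eH ->
    exists Phom Psub, forall n (eG : rel 'I_n) inp,
    simple_graph eG -> degenerate d eG -> adj_encoding eG inp ->
    run c (n.+2 ^ c) inp Phom (c * n.+1 ^ (nedges eH %/ 5 + 3)) = Some (hom eH eG) /\
    run c (n.+2 ^ c) inp Psub (c * n.+1 ^ (nedges eH %/ 5 + 3)) = Some (sub eH eG).
  exists (fun k d => proj1_sig (constructive_indefinite_description _ (H k d))).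
  by move=> d k eH sH /=; case: constructive_indefinite_description => c /= /(_ eH sH).
(* Encoded as finite functions, the patterns on ['I_k] are finitely many, and the sum of their
   constants serves them all. *)
pose rel_of (g : {ffun 'I_k * 'I_k -> bool}) : rel 'I_k := fun i j => g (i, j).
have ex g : exists c0, simple_graph (rel_of g) ->
    exists Phom Psub, forall c n (eG : rel 'I_n) inp, c0 <= c ->
    simple_graph eG -> degenerate d eG -> adj_encoding eG inp ->
    run c (n.+2 ^ c) inp Phom (c * n.+1 ^ (nedges (rel_of g) %/ 5 + 3)) = Some (hom (rel_of g) eG) /\
    run c (n.+2 ^ c) inp Psub (c * n.+1 ^ (nedges (rel_of g) %/ 5 + 3)) = Some (sub (rel_of g) eG).
  case: (excluded_middle_informative (simple_graph (rel_of g))) => [sg|nsg]; last by exists 0.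
  by have [c0 H] := programs d sg; exists c0.
have [g0 g0P] := fin_all_exists ex.
exists (\sum_g g0 g) => eH; pose g := [ffun p : 'I_k * 'I_k => eH p.1 p.2].
have <- : rel_of g = eH.
  by apply: functional_extensionality => i; apply: functional_extensionality => j; rewrite /rel_of ffunE.
move=> /g0P [Phom [Psub H]]; exists Phom, Psub => n eG inp.
by apply: H; rewrite (bigD1 g) //= leq_addr.
Qed.
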